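(* Let $\mathcal{A}_{3,2}$ be the space of affine planes of $\mathbb{E}^3$ with its isometry-invariant measure $dE$, and let $\tilde f:\mathcal{A}_{3,2}\times\mathcal{A}_{3,2}\to\mathbb{R}$ be a measurable function. The measure given by $\tilde f(E_1,E_2)\,dE_1\,dE_2$ on $\mathcal{A}_{3,2}\times\mathcal{A}_{3,2}$ is invariant under isometries of $\mathbb{E}^3$ if and only if $\tilde f(E_1,E_2)=f(\langle u_1,u_2\rangle)$, where $u_i$ is a unit vector with $\pi(E_i)^\perp=\langle u_i\rangle$, $i=1,2$, and $f:[-1,1]\to\mathbb{R}$ is an even measurable function.
   Context: $\mathbb{E}^3$ is Euclidean 3-space, $\mathcal{A}_{3,2}$ is the space of affine planes in $\mathbb{E}^3$, and $\mathrm{Gr}(3,2)$ is the Grassmannian of planes through the origin. For $E\in\mathcal{A}_{3,2}$, $\pi(E)\in\mathrm{Gr}(3,2)$ is the plane through the origin parallel to $E$; $\pi(E)^\perp$ is the line through the origin orthogonal to it, and $\langle u\rangle$ denotes the line spanned by a vector $u$, while $\langle u_1,u_2\rangle$ denotes the scalar product. The isometry-invariant measure $dE$ on $\mathcal{A}_{3,2}$ is normalized by $$\int_{\mathcal{A}_{3,2}} g(E)\,dE=\int_{\mathrm{Gr}(3,2)}\Big(\int_{E_0^\perp} g(E_0+p)\,dp\Big)d\nu(E_0),$$ where $dp$ is Lebesgue measure on the line $E_0^\perp$ and $\nu$ is the isometry-invariant measure on $\mathrm{Gr}(3,2)$ with $\nu(\mathrm{Gr}(3,2))=2\pi$. Write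 $m_{\tilde f}=\tilde f(E_1,E_2)\,dE_1\,dE_2$, that is, $m_{\tilde f}(B)=\int_B\tilde f(E_1,E_2)\,dE_1\,dE_2$. This measure is called invariant under isometries if $m_{\tilde f}(gB)=m_{\tilde f}(B)$ for every Euclidean motion $g$ of $\mathbb{E}^3$, where $g$ acts simultaneously on both planes. Since $f$ is even, $f(\langle u_1,u_2\rangle)$ does not depend on the choice of the unit normals $u_1,u_2$.
   Formalization: The equality f̃(E₁,E₂)=f(⟨u₁,u₂⟩) is taken for almost every pair (E₁,E₂) with respect to dE₁dE₂; pointwise equality fails, e.g. for f̃ the indicator of a single pair of planes, whose measure is zero and so invariant. *)

(* Defs.v *)
From HB Require Import structures.
From mathcomp Require Import all_boot all_order all_algebra.
From mathcomp Require Import all_classical all_reals all_analysis.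
From mathcomp Require Import measurable_realfun.
Set Implicit Arguments.
Unset Strict Implicit.
Unset Printing Implicit Defensive.
Import Order.TTheory GRing.Theory Num.Theory.
Import numFieldNormedType.Exports.
Local Open Scope classical_set_scope.
Local Open Scope ring_scope.

(* The library norm on 'rV[R]_3 is the sup norm (inducing the usual topology),
   so the Euclidean structure of E^3 is spelled out here. *)
Definition dot (R : realType) (u v : 'rV[R]_3) : R :=
  \sum_(i < 3) u 0 i * v 0 i.

Definition enorm (R : realType) (u : 'rV[R]_3) : R := Num.sqrt (dot u u).

Definition isometry3 (R : realType) (g : 'rV[R]_3 -> 'rV[R]_3) : Prop :=
  forall x y, enorm (g x - g y) = enorm (x - y).

Definition Gr32 (R : realType) : Type :=
  {W : {vspace 'rV[R]_3} | \dim W == 2%N}.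

Definition lin_set (R : realType) (W : Gr32 R) : set 'rV[R]_3 :=
  [set x | x \in val W].

Record plane (R : realType) : Type := Plane {
  plane_set :> set 'rV[R]_3 ;
  planeP : exists W p, plane_set = [set p + w | w in lin_set W] }.

Definition translate (R : realType) (W : Gr32 R) (p : 'rV[R]_3) : plane R :=
  Plane (ex_intro _ W (ex_intro _ p erefl)).

(* pi(E); the linear plane W in planeP is uniquely determined by E *)
Definition direction (R : realType) (E : plane R) : Gr32 R :=
  projT1 (cid (planeP E)).

Fact Gr32_inhabited (R : realType) :
  \dim (<[const_mx 1 : 'rV[R]_3]>^C)%VS == 2%N.
Proof.
rewrite dimv_compl dimvf dim_vline /dim /= mul1n.
suff -> : (const_mx 1 : 'rV[R]_3) != 0 by [].
by apply/eqP => /rowP/(_ 0); rewrite !mxE => /eqP; rewrite oner_eq0.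
Qed.

Definition Gr32_point (R : realType) : Gr32 R :=
  exist (fun W : {vspace 'rV[R]_3} => \dim W == 2%N) _ (Gr32_inhabited R).

(* Sets of planes meeting a given open set. They generate the Borel
   sigma-algebra of the Fell topology on closed subsets of E^3, whose traces on
   Gr(3,2) and on A_{3,2} are the usual topologies of these two spaces. *)
Definition hitting_sets (R : realType) (T : Type) (c : T -> set 'rV[R]_3) :
    set (set T) :=
  [set [set E | c E `&` U !=set0] | U in [set U : set 'rV[R]_3 | open U]].

HB.instance Definition _ (R : realType) := SubChoice.on (Gr32 R).
HB.instance Definition _ (R : realType) := isPointed.Build (Gr32 R) (Gr32_point R).
HB.instance Definition _ (R : realType) :=
  @isMeasurable.Build (sigma_display (hitting_sets (@lin_set R))) (Gr32 R)
    <<s hitting_sets (@lin_set R) >>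
    (@sigma_algebra0 _ setT _) (@sigma_algebraC _ _) (@sigma_algebra_bigcup _ setT _).

HB.instance Definition _ (R : realType) := gen_eqMixin (plane R).
HB.instance Definition _ (R : realType) := gen_choiceMixin (plane R).
HB.instance Definition _ (R : realType) :=
  isPointed.Build (plane R) (translate (Gr32_point R) 0).
HB.instance Definition _ (R : realType) :=
  @isMeasurable.Build (sigma_display (hitting_sets (@plane_set R))) (plane R)
    <<s hitting_sets (@plane_set R) >>
    (@sigma_algebra0 _ setT _) (@sigma_algebraC _ _) (@sigma_algebra_bigcup _ setT _).

Definition perp (R : realType) (W : Gr32 R) : set 'rV[R]_3 :=
  [set v | forall w, lin_set W w -> dot v w = 0].

Definition unit_normal (R : realType) (W : Gr32 R) (u : 'rV[R]_3) : Prop :=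
  enorm u = 1 /\ perp W = [set x | x \in <[u]>%VS].

(* Integral over the line W^\perp with respect to its Lebesgue measure: the line
   is parametrized by arc length, and either unit normal gives the same value. *)
Definition perp_integral (R : realType) (W : Gr32 R)
    (h : 'rV[R]_3 -> \bar R) : \bar R :=
  let u := xget 0 [set u | unit_normal W u] in
  (\int[@lebesgue_measure R]_(t in setT) h (t *: u))%E.

(* The image gS, for objects represented by the subsets c E of E^3: the members
   F are those representing g(E) for some E in S. *)
Definition moved (R : realType) (T : Type) (c : T -> set 'rV[R]_3)
    (g : 'rV[R]_3 -> 'rV[R]_3) (S : set T) : set T :=
  [set F | exists2 E, S E & c F = g @` c E].

Definition moved_pairs (R : realType) (g : 'rV[R]_3 -> 'rV[R]_3)
    (B : set (plane R * plane R)) : set (plane R * plane R) :=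
  [set F | exists2 E, B E &
     plane_set F.1 = g @` E.1 /\ plane_set F.2 = g @` E.2].

(* These conditions determine nu. *)
Definition is_grassmann_measure (R : realType)
    (nu : {measure set (Gr32 R) -> \bar R}) : Prop :=
  (forall g S, isometry3 g -> g 0 = 0 -> measurable S ->
     nu (moved (@lin_set R) g S) = nu S)
  /\ nu setT = (2 * pi)%:E.

(* These conditions determine dE (once nu is given). *)
Definition is_plane_measure (R : realType)
    (nu : {measure set (Gr32 R) -> \bar R})
    (dE : {sigma_finite_measure set (plane R) -> \bar R}) : Prop :=
  (forall g S, isometry3 g -> measurable S ->
     dE (moved (@plane_set R) g S) = dE S)
  /\ (forall h : plane R -> \bar R, measurable_fun setT h ->
        (forall E, (0 <= h E)%E) ->
        (\int[dE]_(E in setT) h E =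
         \int[nu]_(E0 in setT) perp_integral E0 (fun p => h (translate E0 p)))%E).

(* m_f(B). For f of variable sign this is the difference of the integrals of
   the positive and negative parts, in \bar R. *)
Definition density_measure (R : realType)
    (dE : {sigma_finite_measure set (plane R) -> \bar R})
    (f : plane R * plane R -> R) (B : set (plane R * plane R)) : \bar R :=
  (\int[dE \x dE]_(E in B) (f E)%:E)%E.

Definition isometry_invariant (R : realType)
    (m : set (plane R * plane R) -> \bar R) : Prop :=
  forall g B, isometry3 g -> measurable B -> m (moved_pairs g B) = m B.

(* Main.v *)
(* By sigma-finiteness, the density measure is invariant iff, for each motion g,
   ft(gE) = ft(E) for almost every pair E.  If ft depends on the angle alone this
   is clear.  Conversely, one needs a single null set valid for all g.  A pair y
   of non-parallel planes has a Gram-Schmidt frame, so together with a vector it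
   defines a motion g_y; almost all pairs are non-parallel, because an invariant
   finite measure on Gr(3,2) has no atoms.  The measure dE dE dp on these
   parameters is preserved by right translations g_y -> g_y h, up to signs of the
   frame, so it plays the role of a Haar measure on the group of motions.  By Fubini, for
   almost every E, ft(g_y E) = ft(E) for almost every y.  The set of E for which
   y -> ft(g_y E) is almost surely constant, and the value of this constant, are
   then exactly invariant; as motions act transitively on the pairs of planes
   with a given angle, the constant is a function of the angle, which is
   measurable since it is an average of ft(g_y E_s) over y, where E_s is a
   measurable family of pairs with cosine s. *)
From HB Require Import structures.
From mathcomp Require Import all_boot all_order all_algebra.
From mathcomp Require Import all_classical all_reals all_analysis.
From mathcomp Require Import measurable_realfun.
From mathcomp Require Import ring lra.
Require Import Defs.
Set Implicit Arguments.
Unset Strict Implicit.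
Unset Printing Implicit Defensive.
Import Order.TTheory GRing.Theory Num.Theory.
Import numFieldNormedType.Exports.
Local Open Scope classical_set_scope.
Local Open Scope ring_scope.

(** * Euclidean geometry *)

Section Euclidean.
Context {R : realType}.
Implicit Types (u v w n : 'rV[R]_3) (M : 'M[R]_3).

Lemma sum3 (F : 'I_3 -> R) : \sum_(i < 3) F i = F 0 + F 1 + F 2.
Proof.
rewrite !big_ord_recr big_ord0 /= add0r.
by congr (F _ + F _ + F _); apply/val_inj.
Qed.

Lemma dot3 u v : dot u v = u 0 0 * v 0 0 + u 0 1 * v 0 1 + u 0 2 * v 0 2.
Proof. by rewrite /dot sum3. Qed.

Lemma ord3P (P : 'I_3 -> Prop) : P 0 -> P 1 -> P 2 -> forall i, P i.
Proof.
move=> h0 h1 h2 [[|[|[|//]]] i] /=.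
- by have -> : Ordinal i = 0 by apply/val_inj.
- by have -> : Ordinal i = 1 by apply/val_inj.
- by have -> : Ordinal i = 2 by apply/val_inj.
Qed.

Lemma row3P u v : u 0 0 = v 0 0 -> u 0 1 = v 0 1 -> u 0 2 = v 0 2 -> u = v.
Proof. by move=> h0 h1 h2; apply/rowP; exact: ord3P. Qed.

Lemma dot_mulmx u v : dot u v = (u *m v^T) 0 0.
Proof. by rewrite mxE; apply: eq_bigr => i _; rewrite mxE. Qed.

Lemma dotC u v : dot u v = dot v u.
Proof. by rewrite !dot3; ring. Qed.

Lemma dotDl u v w : dot (u + v) w = dot u w + dot v w.
Proof. by rewrite !dot3 !mxE; ring. Qed.

Lemma dotDr u v w : dot w (u + v) = dot w u + dot w v.
Proof. by rewrite !dot3 !mxE; ring. Qed.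

Lemma dotNl u w : dot (- u) w = - dot u w.
Proof. by rewrite !dot3 !mxE; ring. Qed.

Lemma dotNr u w : dot w (- u) = - dot w u.
Proof. by rewrite !dot3 !mxE; ring. Qed.

Lemma dotBl u v w : dot (u - v) w = dot u w - dot v w.
Proof. by rewrite dotDl dotNl. Qed.

Lemma dotBr u v w : dot w (u - v) = dot w u - dot w v.
Proof. by rewrite dotDr dotNr. Qed.

Lemma dotZl a u w : dot (a *: u) w = a * dot u w.
Proof. by rewrite !dot3 !mxE; ring. Qed.

Lemma dotZr a u w : dot w (a *: u) = a * dot w u.
Proof. by rewrite !dot3 !mxE; ring. Qed.

Lemma dot0r u : dot u 0 = 0.
Proof. by rewrite !dot3 !mxE; ring. Qed.

Lemma dot_ge0 u : 0 <= dot u u.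
Proof. by rewrite dot3 !addr_ge0 // -expr2 sqr_ge0. Qed.

Lemma dot_eq0 u : dot u u = 0 -> u = 0.
Proof.
rewrite dot3 => h.
have h0 := sqr_ge0 (u 0 0); have h1 := sqr_ge0 (u 0 1).
have h2 := sqr_ge0 (u 0 2).
by apply: row3P; rewrite !mxE; apply/eqP; rewrite -sqrf_eq0; apply/eqP; nra.
Qed.

Lemma dot_gt0 u : u != 0 -> 0 < dot u u.
Proof.
move=> u0; rewrite lt_neqAle dot_ge0 andbT eq_sym.
by apply: contra u0 => /eqP/dot_eq0 ->.
Qed.

Lemma enormE u v : enorm u = enorm v <-> dot u u = dot v v.
Proof.
rewrite /enorm; split => [/eqP|->//].
by rewrite eqr_sqrt ?dot_ge0 // => /eqP.
Qed.

Lemma enorm1 u : enorm u = 1 <-> dot u u = 1.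
Proof.
rewrite /enorm; split => [h|->]; last by rewrite sqrtr1.
by rewrite -[LHS]sqr_sqrtr ?dot_ge0 // h expr1n.
Qed.

(** Lagrange's identity: the difference of the two sides is the sum of the three squares introduced
    below. *)
Lemma cauchy_schwarz u v : dot u v ^+ 2 <= dot u u * dot v v.
Proof.
rewrite !dot3.
have h0 := sqr_ge0 (u 0 0 * v 0 1 - u 0 1 * v 0 0).
have h1 := sqr_ge0 (u 0 0 * v 0 2 - u 0 2 * v 0 0).
have h2 := sqr_ge0 (u 0 1 * v 0 2 - u 0 2 * v 0 1).
nra.
Qed.

Definition orth M : Prop := M *m M^T = 1%:M.

Lemma orthT M : orth M -> orth M^T.
Proof. by rewrite /orth trmxK => /mulmx1C. Qed.

Lemma orthM M M' : orth M -> orth M' -> orth (M *m M').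
Proof.
rewrite /orth => hM hM'.
by rewrite trmx_mul mulmxA -(mulmxA M M') hM' mulmx1.
Qed.

Lemma orth_dot M u v : orth M -> dot (u *m M) (v *m M) = dot u v.
Proof.
by move=> hM; rewrite !dot_mulmx trmx_mul mulmxA -(mulmxA u M) hM mulmx1.
Qed.

Lemma orthK M u : orth M -> u *m M^T *m M = u.
Proof. by move=> /orthT hM; rewrite -mulmxA -{2}(trmxK M) hM mulmx1. Qed.

Lemma orth_rows M :
  (forall i j, dot (row i M) (row j M) = (i == j)%:R) -> orth M.
Proof.
move=> h; apply/matrixP => i j; rewrite !mxE -h.
by apply: eq_bigr => k _; rewrite !mxE.
Qed.

Lemma dot_row M u i : dot u (row i M) = (u *m M^T) 0 i.
Proof. by rewrite mxE; apply: eq_bigr => k _; rewrite !mxE. Qed.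

Lemma orth_ext M u v :
  orth M -> (forall i, dot u (row i M) = dot v (row i M)) -> u = v.
Proof.
move=> hM h; rewrite -(orthK u hM) -(orthK v hM); congr (_ *m _).
by apply/rowP => i; rewrite -!dot_row.
Qed.

Lemma affine_isometry M w : orth M -> isometry3 (fun x => x *m M + w).
Proof.
move=> hM x y; apply/enormE.
by rewrite opprD addrACA subrr addr0 -mulmxBl orth_dot.
Qed.

(** By polarization [L] preserves scalar products, hence sends the standard basis to an orthonormal
    one. The coordinates of [L x] in that basis are those of [x], which gives linearity without
    assuming it. *)
Lemma isometry_affine g : isometry3 g ->
  exists M, orth M /\ forall x, g x = x *m M + g 0.
Proof.
move=> hg; pose L x := g x - g 0.
have hgd x y : dot (g x - g y) (g x - g y) = dot (x - y) (x - y).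
  exact/enormE/hg.
have hL x y : dot (L x) (L y) = dot x y.
  have := hgd x 0; have := hgd y 0; have := hgd x y.
  rewrite subr0 (_ : g x - g y = L x - L y); last first.
    by rewrite /L opprB addrA subrK.
  rewrite -/(L x) -/(L y) subr0; move: (L x) (L y) => a b.
  rewrite !(dotBl, dotBr) (dotC b a) (dotC y x) => h1 h2 h3; lra.
pose M := \matrix_i L (delta_mx 0 i).
have hM : orth M.
  apply: orth_rows => i j.
  rewrite !rowK hL dot_mulmx trmx_delta mul_delta_mx_cond.
  by case: (eqVneq i j) => _; rewrite ?mulr1n ?mulr0n mxE ?eqxx.
exists M; split => // x; apply/eqP; rewrite -subr_eq; apply/eqP.
apply: (orth_ext hM) => i.
transitivity (dot x (delta_mx 0 i)); first by rewrite rowK -(hL x).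
by rewrite -(orth_dot x _ hM) rowE.
Qed.

Definition hplane n (d : R) : set 'rV[R]_3 := [set x | dot n x = d].

Lemma hplaneN n d : hplane (- n) (- d) = hplane n d.
Proof.
by apply/seteqP; split => x; rewrite /hplane /= dotNl; [exact: oppr_inj|move->].
Qed.

Lemma hplane_point n d : dot n n = 1 -> hplane n d (d *: n).
Proof. by move=> h; rewrite /hplane /= dotZr h mulr1. Qed.

Lemma hplane_image M w n d : orth M ->
  [set x *m M + w | x in hplane n d] = hplane (n *m M) (d + dot (n *m M) w).
Proof.
move=> hM; apply/seteqP; split => [_ [x hx <-]|y hy].
  by rewrite /hplane /= dotDr orth_dot // hx.
exists ((y - w) *m M^T); last by rewrite orthK // subrK.
by rewrite /hplane /= -(orth_dot _ _ hM) orthK // dotBr hy addrK.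
Qed.

(** Let [m] be the component of [n'] orthogonal to [n]. Both [d *: n] and [d *: n + m] lie in the
    plane, so [m] is orthogonal to [n'] too, which forces [m = 0]. *)
Lemma hplane_inj n d n' d' : dot n n = 1 -> dot n' n' = 1 ->
  hplane n d = hplane n' d' -> (n' = n /\ d' = d) \/ (n' = - n /\ d' = - d).
Proof.
move=> hn hn' h.
have hd : dot n' (d *: n) = d' by have := hplane_point d hn; rewrite h.
pose k := dot n n'; pose m := n' - k *: n.
have /dot_eq0/eqP : dot m m = 0.
  have : hplane n d (d *: n + m).
    rewrite /hplane /= dotDr dotZr hn mulr1 dotBr dotZr hn mulr1 -/k.
    by rewrite subrr addr0.
  rewrite h /hplane /= dotDr hd => /eqP; rewrite -subr_eq0 addrAC subrr add0r.
  move=> /eqP e; rewrite {1}/m dotBl e dotZl dotBr dotZr hn -/k mulr1 subrr.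
  by rewrite mulr0 subr0.
rewrite subr_eq0 => /eqP e.
have : k ^+ 2 = 1 by move: hn'; rewrite e dotZl dotZr hn mulr1 -expr2.
move/eqP; rewrite sqrf_eq1 => /orP[]/eqP k1; rewrite k1 in e.
- left; rewrite scale1r in e; split => //.
  by rewrite -hd e dotZr hn mulr1.
- right; rewrite scaleN1r in e; split => //.
  by rewrite -hd e dotZr dotNl hn mulrN1.
Qed.

Lemma lin_set_inj : injective (@lin_set R).
Proof.
move=> W W' h; apply/val_inj/vspaceP => x.
by apply/idP/idP => hx; [have : lin_set W x by []|have : lin_set W' x by []];
  rewrite ?h // -h.
Qed.

Definition dot_ker n : {vspace 'rV[R]_3} := lker (linfun (mulmxr n^T)).

Lemma mem_dot_ker n x : (x \in dot_ker n) = (dot n x == 0).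
Proof.
rewrite memv_ker lfunE /= dotC dot_mulmx; apply/eqP/eqP => [->|h].
  by rewrite mxE.
by apply/matrixP => i j; rewrite !ord1 h mxE.
Qed.

Lemma dim_dot_ker n : n != 0 -> \dim (dot_ker n) = 2%N.
Proof.
move=> n0; pose f : 'Hom('rV[R]_3, 'rV[R]_1) := linfun (mulmxr n^T).
have := limg_ker_dim f fullv.
rewrite capfv -/(dot_ker n) dimvf /dim /= mul1n => h.
have l1 : (\dim (limg f) <= 1)%N.
  by apply: leq_trans (dimvS (subvf _)) _; rewrite dimvf /dim.
suff : (0 < \dim (limg f))%N.
  by move: h l1; case: (\dim (limg f)) => [|[|l]] //; rewrite addn1 => -[].
rewrite lt0n dimv_eq0; apply/negP => /eqP l0.
have : f n \in limg f by exact/memv_img/memvf.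
rewrite l0 memv0 lfunE /= => /eqP e.
by move: n0; rewrite (@dot_eq0 n) ?eqxx // dot_mulmx e mxE.
Qed.

Lemma linear_plane_ex n : n != 0 -> exists W : Gr32 R, lin_set W = hplane n 0.
Proof.
move=> n0; have h : \dim (dot_ker n) == 2%N by rewrite dim_dot_ker.
exists (exist (fun W : {vspace 'rV[R]_3} => \dim W == 2%N) _ h); apply/seteqP.
by split => x; rewrite /lin_set /hplane /= mem_dot_ker => /eqP.
Qed.

Lemma dot1_neq0 n : dot n n = 1 -> n != 0.
Proof.
move=> h; apply/eqP => n0; move: h; rewrite n0 dot0r => /eqP.
by rewrite eq_sym oner_eq0.
Qed.

Lemma hplane_unit n d : n != 0 ->
  exists n' d', dot n' n' = 1 /\ hplane n d = hplane n' d'.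
Proof.
move=> n0; have p0 := dot_gt0 n0.
have s0 : Num.sqrt (dot n n) != 0 by rewrite sqrtr_eq0 -ltNge.
exists ((Num.sqrt (dot n n))^-1 *: n), ((Num.sqrt (dot n n))^-1 * d); split.
  rewrite dotZl dotZr mulrA -invfM -expr2 sqr_sqrtr ?dot_ge0 // mulVf //.
  by rewrite gt_eqF.
apply/seteqP; split => x; rewrite /hplane /= dotZl; first by move->.
by move/(mulfI (invr_neq0 s0)).
Qed.

Lemma lin_set_perp (W : Gr32 R) n : n != 0 -> perp W n -> lin_set W = hplane n 0.
Proof.
move=> n0 hn; suff -> : lin_set W = [set x | x \in dot_ker n].
  by apply/seteqP; split => x; rewrite /hplane /= mem_dot_ker => /eqP.
suff : val W == dot_ker n by rewrite /lin_set => /eqP ->.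
rewrite eqEdim dim_dot_ker // (eqP (valP W)) leqnn andbT.
by apply/subvP => x hx; rewrite mem_dot_ker; apply/eqP/hn.
Qed.

Lemma lin_set_hplane (W : Gr32 R) :
  exists n, dot n n = 1 /\ lin_set W = hplane n 0.
Proof.
suff [n n0 hn] : exists2 n, n != 0 & perp W n.
  have [n' [d' [h1 h]]] := hplane_unit 0 n0.
  exists n'; split => //; rewrite (lin_set_perp n0 hn) h.
  suff -> : d' = 0 by [].
  have : hplane n 0 0 by rewrite /hplane /= dot0r.
  by rewrite h /hplane /= dot0r.
pose B := \matrix_(i < \dim (val W)) (vbasis (val W))`_i.
(* A normal is a nonzero vector killed by the basis vectors of [W]; it exists because [B] has only
   two rows in dimension three. *)
have : kermx B^T != 0.
  rewrite -mxrank_eq0 mxrank_ker -lt0n subn_gt0.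
  by rewrite (leq_ltn_trans (rank_leq_col _)) // (eqP (valP W)).
case/rowV0Pn => n /sub_kermxP hn n0; exists n => // w hw.
rewrite dot_mulmx (coord_vbasis hw) linear_sum /= mulmx_sumr summxE.
rewrite big1 // => i _.
rewrite linearZ /= -scalemxAr mxE.
have /matrixP/(_ 0 i) := hn; rewrite [in X in X -> _]mxE mxE => e.
rewrite (_ : (_ *m _) 0 0 = 0) ?mulr0 // -[RHS]e mxE.
by apply: eq_bigr => k _; rewrite !mxE.
Qed.

End Euclidean.

(** * A countable base of balls, and the planes that meet a ball *)

Section OpenSets.
Context {R : realType}.
Implicit Types (u v w n x y q : 'rV[R]_3).

Definition vec3 (a b c : R) : 'rV[R]_3 := \row_i [:: a; b; c]`_i.

Lemma vec3E a b c :
  (vec3 a b c 0 0 = a) * (vec3 a b c 0 1 = b) * (vec3 a b c 0 2 = c).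
Proof. by rewrite !mxE. Qed.

Lemma vec3_eta u : u = vec3 (u 0 0) (u 0 1) (u 0 2).
Proof. by apply: row3P; rewrite vec3E. Qed.

Definition sqdist x y : R := dot (x - y) (x - y).

Lemma open_sqdist q (r : R) : open [set x | sqdist x q < r].
Proof.
have cf : continuous (fun x => sqdist x q).
  rewrite /sqdist; under eq_fun do rewrite dot3 !mxE.
  move=> x; have cc (i : 'I_3) : (fun y : 'rV[R]_3 => y 0 i - q 0 i) @ nbhs x
      --> x 0 i - q 0 i.
    by apply: cvgB; [exact: (@coord_continuous R _ _ 0 i x)|exact: cvg_cst].
  have mm (i : 'I_3) :
      (fun y : 'rV[R]_3 => (y 0 i - q 0 i) * (y 0 i - q 0 i)) @ nbhs x
      --> (x 0 i - q 0 i) * (x 0 i - q 0 i).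
    by apply: (@cvgM _ _ (nbhs x)); exact: cc.
  by apply: (@cvgD _ _ _ (nbhs x)) (mm 2); apply: (@cvgD _ _ _ (nbhs x)).
exact: (open_comp (fun x _ => cf x) (@open_lt R r)).
Qed.

Lemma open_sqdist_ball (U : set 'rV[R]_3) x : open U -> U x ->
  exists2 e : R, 0 < e & forall y, sqdist y x < e ^+ 2 -> U y.
Proof.
move=> oU Ux; have /nbhs_ballP[e /= e0 h] := open_nbhs_nbhs (conj oU Ux).
exists e => // y yx; apply: h; split => // i j.
rewrite !ord1 -ball_normE /= distrC -ltr_sqr ?nnegrE ?(ltW e0) //.
rewrite real_normK ?num_real //; apply: le_lt_trans yx.
rewrite /sqdist /dot (bigD1 j) //= !mxE -expr2 lerDl sumr_ge0 // => k _.
by rewrite -expr2 sqr_ge0.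
Qed.

(** Countably many balls forming a base of the topology: meeting an open set becomes a countable
    union of conditions on balls. *)
Definition rat_ball (b : rat * rat * rat * rat) : set 'rV[R]_3 :=
  [set x | sqdist x (vec3 (ratr b.1.1.1) (ratr b.1.1.2) (ratr b.1.2))
           < ratr b.2 ^+ 2].

Lemma open_rat_ball (U : set 'rV[R]_3) x : open U -> U x ->
  exists b, [/\ 0 < b.2, rat_ball b `<=` U & rat_ball b x].
Proof.
move=> oU Ux; have [e e0 h] := open_sqdist_ball oU Ux.
(* A centre within [r / 2] of [x] in each coordinate is at squared distance less than
   [3 / 4 * r ^+ 2], so the ball contains [x]; its points are then within [2 * r < e] of [x]. *)
have [r] := @rat_in_itvoo R 0 (e / 2) (divr_gt0 e0 (ltr0n _ 2)).
rewrite in_itv /= => /andP[r0 re].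
have hq (t : R) : exists q : rat, `|t - ratr q| < ratr r / 2.
  have [|q] := @rat_in_itvoo R (t - ratr r / 2) (t + ratr r / 2).
    by lra.
  by rewrite in_itv /= => /andP[q1 q2]; exists q; rewrite ltr_distlC q1.
have [a ha] := hq (x 0 0); have [b hb] := hq (x 0 1); have [c hc] := hq (x 0 2).
exists (a, b, c, r); rewrite /rat_ball /=.
have hs (t s : R) : `|t - s| < ratr r / 2 -> (t - s) ^+ 2 < ratr r ^+ 2 / 4.
  move=> ts; rewrite -real_normK ?num_real // (_ : _ / 4 = (ratr r / 2) ^+ 2).
    by rewrite ltr_sqr // nnegrE // ltW // divr_gt0.
  by field.
move: (hs _ _ ha) (hs _ _ hb) (hs _ _ hc) => {ha hb hc hs hq} ha hb hc.
split; first by rewrite -(ltr0q R).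
- move=> y hy; apply: h; apply: (@lt_trans _ _ ((ratr r * 2) ^+ 2)); last first.
    have r2 : 0 < (ratr r : R) * 2 by lra.
    by rewrite ltr_sqr ?nnegrE ?(ltW r2) ?(ltW e0) //; lra.
  move: hy; rewrite /= /sqdist !dot3 !mxE /= => hy.
  have h1 := sqr_ge0 (y 0 0 - ratr a + (x 0 0 - ratr a)).
  have h2 := sqr_ge0 (y 0 1 - ratr b + (x 0 1 - ratr b)).
  have h3 := sqr_ge0 (y 0 2 - ratr c + (x 0 2 - ratr c)).
  move: ha hb hc hy h1 h2 h3; move: (ratr a) (ratr b) (ratr c) (ratr r).
  move: (y 0 0) (y 0 1) (y 0 2) (x 0 0) (x 0 1) (x 0 2).
  move=> y0 y1 y2 x0 x1 x2 a' b' c' r' ha hb hc hy h1 h2 h3; nra.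
- rewrite /sqdist dot3 !mxE /=.
  have hr : 0 < (ratr r : R) ^+ 2 by rewrite exprn_gt0.
  move: ha hb hc hr; move: (ratr a) (ratr b) (ratr c) (ratr r).
  move=> a' b' c' r' ha hb hc hr; nra.
Qed.

(** The point of the plane nearest to [q] is its orthogonal projection [q - k *: n]. Here [r] is the
    squared radius. *)
Lemma hplane_hits_ball n (d : R) q (r : R) : n != 0 ->
  (hplane n d `&` [set x | sqdist x q < r]) !=set0 <->
  (dot n q - d) ^+ 2 < r * dot n n.
Proof.
move=> n0; have p0 := dot_gt0 n0.
split.
  case=> x [/= hx hr]; rewrite -sqrrN opprB -hx -dotBr.
  apply: le_lt_trans (cauchy_schwarz _ _) _.
  by rewrite mulrC ltr_pM2r.
move=> h; pose k := (dot n q - d) / dot n n; exists (q - k *: n); split.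
  rewrite /hplane /= dotBr dotZr /k divfK ?gt_eqF //.
  by rewrite opprB addrC subrK.
rewrite /= /sqdist addrAC subrr add0r dotNl dotNr opprK dotZl dotZr /k.
rewrite -ltr_pdivrMr // in h; suff <- : (dot n q - d) ^+ 2 / dot n n =
  (dot n q - d) / dot n n * ((dot n q - d) / dot n n * dot n n) by [].
by field; rewrite gt_eqF.
Qed.

End OpenSets.

(** * Affine planes *)

Section Planes.
Context {R : realType}.
Implicit Types (u v w n x y q : 'rV[R]_3) (M : 'M[R]_3) (E F : plane R).

Lemma plane_set_inj : injective (@plane_set R).
Proof.
move=> [A hA] [B hB] /= e; case: _ / e hB => hB.
by congr Plane; exact: Prop_irrelevance.
Qed.

Lemma plane_direction E :
  exists p, plane_set E = [set p + w | w in lin_set (direction E)].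
Proof. exact: projT2 (cid (planeP E)). Qed.

Lemma translate_hplane (W : Gr32 R) n p : lin_set W = hplane n 0 ->
  plane_set (translate W p) = hplane n (dot n p).
Proof.
move=> hW; apply/seteqP; split => [_ [w + <-]|x hx].
  by rewrite hW /hplane /= dotDr => ->; rewrite addr0.
exists (x - p); last by rewrite addrC subrK.
by rewrite hW /hplane /= dotBr hx subrr.
Qed.

(** The normal need not be a unit vector. At [n = 0] the value is one fixed plane whatever [d] is,
    so the map is total and still measurable. *)
Definition mkplane n (d : R) : plane R :=
  if n == 0 then point
  else xget point [set E : plane R | plane_set E = hplane n d].

Lemma mkplane0 d : mkplane 0 d = point.
Proof. by rewrite /mkplane eqxx. Qed.

Lemma mkplaneE n d : n != 0 -> plane_set (mkplane n d) = hplane n d.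
Proof.
move=> n0; rewrite /mkplane (negbTE n0); case: xgetP => [E -> //|].
have [n' [d' [h1 ->]]] := hplane_unit d n0.
have [W hW] := linear_plane_ex (dot1_neq0 h1).
move=> /(_ (translate W (d' *: n'))); case.
by apply: etrans (translate_hplane _ hW) _; rewrite dotZr h1 mulr1.
Qed.

Lemma plane_hplane E :
  exists n, exists d, dot n n = 1 /\ plane_set E = hplane n d.
Proof.
have [p hp] := plane_direction E.
have [n [n1 hn]] := lin_set_hplane (direction E).
exists n, (dot n p); split => //.
by rewrite hp -(translate_hplane p hn).
Qed.

(** This trades the chosen [direction] for an equation of the plane, the form in which motions are
    computed. *)
Lemma unit_normal_hplane E u : unit_normal (direction E) u <->
  dot u u = 1 /\ exists d, plane_set E = hplane u d.
Proof.
rewrite /unit_normal enorm1.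
have [p hp] := plane_direction E; split => [[u1 hu]|[u1 [d hd]]]; split => //.
  exists (dot u p); rewrite hp -(@translate_hplane (direction E)) //.
  apply: lin_set_perp; first exact: dot1_neq0.
  by rewrite hu /= memv_line.
have hW : lin_set (direction E) = hplane u 0.
  have hdp : dot u p = d.
    have : plane_set E p.
      rewrite hp; exists 0; last by rewrite addr0.
      by rewrite /lin_set /= mem0v.
    by rewrite hd.
  apply/seteqP; split => [w hw|w hw].
    have : plane_set E (p + w) by rewrite hp; exists w.
    rewrite hd /hplane /= dotDr hdp => /eqP.
    by rewrite -subr_eq0 addrAC subrr add0r => /eqP.
  have : plane_set E (p + w) by rewrite hd /hplane /= dotDr hdp hw addr0.
  by rewrite hp => -[w' hw' /addrI <-].
rewrite /perp hW; apply/seteqP; split => [v /= hv|v /= /vlineP[k ->]]; last first.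
  by move=> w; rewrite /hplane /= => h; rewrite dotZl h mulr0.
pose m := v - dot u v *: u.
have hm : dot u m = 0 by rewrite dotBr dotZr u1 mulr1 subrr.
have : dot m m = 0 by rewrite {1}/m dotBl dotZl hm mulr0 subr0; exact: hv.
move/dot_eq0/eqP; rewrite subr_eq0 => /eqP ->; exact/memvZ/memv_line.
Qed.

Lemma unit_normal_ex E : exists u, unit_normal (direction E) u.
Proof.
have [n [d [n1 h]]] := plane_hplane E.
by exists n; apply/unit_normal_hplane; split => //; exists d.
Qed.

(** An arbitrary choice between two opposite normals. Only expressions unchanged when normal and
    offset both change sign can be expected to be measurable. *)
Definition some_normal E : 'rV[R]_3 := projT1 (cid (plane_hplane E)).

Definition some_offset E : R := projT1 (cid (projT2 (cid (plane_hplane E)))).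

Lemma some_normalP E : dot (some_normal E) (some_normal E) = 1 /\
  plane_set E = hplane (some_normal E) (some_offset E).
Proof. exact: projT2 (cid (projT2 (cid (plane_hplane E)))). Qed.

(* The sign of the first nonzero coordinate makes the choice of one of the two
   unit normals measurable. *)
Definition normal_sign E : R :=
  let n := some_normal E in
  if n 0 0 != 0 then Num.sg (n 0 0)
  else if n 0 1 != 0 then Num.sg (n 0 1) else Num.sg (n 0 2).

Lemma normal_sign2 E : normal_sign E * normal_sign E = 1.
Proof.
rewrite /normal_sign; set n := some_normal E; rewrite -expr2.
case: ifPn => [h|/negPn/eqP h0]; first by rewrite sqr_sg h.
case: ifPn => [h|/negPn/eqP h1]; first by rewrite sqr_sg h.
rewrite sqr_sg; case: eqP => [h2|//].
have [+ _] := some_normalP E; rewrite -/n dot3 h0 h1 h2 !mulr0 !addr0 => /eqP.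
by rewrite eq_sym oner_eq0.
Qed.

Definition normal E : 'rV[R]_3 := normal_sign E *: some_normal E.

Definition offset E : R := normal_sign E * some_offset E.

Lemma normal1 E : dot (normal E) (normal E) = 1.
Proof.
by rewrite dotZl dotZr mulrA normal_sign2 mul1r; case: (some_normalP E).
Qed.

Lemma normal_offset E : plane_set E = hplane (normal E) (offset E).
Proof.
have [_ {1}->] := some_normalP E; have s2 := normal_sign2 E.
have s0 : normal_sign E != 0.
  by apply/eqP => s0; move: s2 => /eqP; rewrite s0 mulr0 eq_sym oner_eq0.
apply/seteqP; split => x; rewrite /hplane /= dotZl; first by move->.
exact: mulfI.
Qed.

Lemma normal_neq0 E : normal E != 0.
Proof. exact/dot1_neq0/normal1. Qed.

Lemma mkplaneK E : mkplane (normal E) (offset E) = E.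
Proof.
by apply: plane_set_inj; rewrite mkplaneE ?normal_neq0 // -normal_offset.
Qed.

End Planes.

(** * Measurable coordinates of planes *)

Section RealMeasurability.
Context {R : realType}.

Lemma measurable_sqrt : measurable_fun setT (@Num.sqrt R).
Proof. by apply: continuous_measurable_fun; exact: sqrt_continuous. Qed.

Lemma measurable_neq0 d (T : measurableType d) (f : T -> R) :
  measurable_fun setT f -> measurable_fun setT (fun x => f x != 0).
Proof.
move=> mf; apply: (@measurable_neg _ _ _ (fun x => f x == 0)).
exact: (measurable_fun_eqr mf (measurable_cst (0 : R))).
Qed.

Lemma measurable_lt d (T : measurableType d) (f g : T -> R) :
  measurable_fun setT f -> measurable_fun setT g ->
  measurable [set x | f x < g x].
Proof.
move=> mf mg; have /(_ measurableT [set true]) := measurable_fun_ltr mf mg.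
rewrite setTI; exact.
Qed.

Lemma measurable_inv : measurable_fun setT (@GRing.inv R).
Proof.
rewrite (_ : @GRing.inv R = fun x => if x != 0 then x^-1 else 0); last first.
  by apply/funext => x; case: ifPn => // /negPn/eqP ->; rewrite invr0.
apply: measurable_fun_if => //.
- exact: measurable_neq0.
- rewrite setTI; apply: open_continuous_measurable_fun.
    rewrite (_ : _ @^-1` _ = [set x | x != 0]); first exact: open_neq.
    by apply/seteqP; split.
  by move=> x; rewrite inE; exact: inv_continuous.
Qed.

Lemma measurable_funV d (T : measurableType d) (f : T -> R) :
  measurable_fun setT f -> measurable_fun setT (fun x => (f x)^-1).
Proof. by move=> mf; apply: measurableT_comp mf; exact: measurable_inv. Qed.

Lemma measurable_fun_sqrt d (T : measurableType d) (f : T -> R) :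
  measurable_fun setT f -> measurable_fun setT (fun x => Num.sqrt (f x)).
Proof. by move=> mf; apply: measurableT_comp mf; exact: measurable_sqrt. Qed.

End RealMeasurability.

Section PlaneMeasurability.
Context {R : realType}.
Implicit Types (u v w n x y q : 'rV[R]_3) (M : 'M[R]_3) (E F : plane R).

Lemma measurable_hitting (U : set 'rV[R]_3) : open U ->
  measurable [set E : plane R | plane_set E `&` U !=set0].
Proof. by move=> oU; apply: sub_sigma_algebra; exists U. Qed.

Let residual q E := dot (some_normal E) q - some_offset E.

(** The square is the squared distance from [q] to [E], independent of the chosen sign. It is less
    than [r] exactly when [E] meets the ball of squared radius [r], which is a generating event. *)
Let measurable_residual2 q :
  measurable_fun setT (fun E => residual q E ^+ 2 : R).
Proof.
apply: (measurability _ (RGenInftyO.measurableE R)) => // _ [_ [r ->] <-].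
rewrite setTI (_ : _ @^-1` _ =
    [set E : plane R | plane_set E `&` [set x | sqdist x q < r] !=set0]).
  apply: measurable_hitting; exact: open_sqdist.
apply/seteqP; have h E : residual q E ^+ 2 < r <->
    (plane_set E `&` [set x | sqdist x q < r]) !=set0.
  have [n1 ->] := some_normalP E.
  by rewrite hplane_hits_ball ?dot1_neq0 // n1 mulr1.
by split => E /=; rewrite in_itv /= => /h.
Qed.

Let measurable_no i :
  measurable_fun setT (fun E => some_normal E 0 i * some_offset E : R).
Proof.
pose b : 'rV[R]_3 := delta_mx 0 i.
have hb n : dot n b = n 0 i.
  by rewrite dot_mulmx trmx_delta -colE mxE.
(* Polarization recovers the products of coordinates of normal and offset from squared distances. *)
rewrite (_ : (fun _ => _) = fun E =>
    4^-1 * (residual (- b) E ^+ 2 - residual b E ^+ 2)); last first.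
  by apply/funext => E; rewrite /residual dotNr hb; field.
by apply: measurable_funM => //; apply: measurable_funB.
Qed.

Let measurable_nn i j :
  measurable_fun setT (fun E => some_normal E 0 i * some_normal E 0 j : R).
Proof.
pose b k : 'rV[R]_3 := delta_mx 0 k.
have hb n k : dot n (b k) = n 0 k.
  by rewrite dot_mulmx trmx_delta -colE mxE.
rewrite (_ : (fun _ => _) = fun E =>
    4^-1 * (residual (b i + b j) E ^+ 2 - residual (b i - b j) E ^+ 2)
    + some_normal E 0 j * some_offset E); last first.
  by apply/funext => E; rewrite /residual dotDr dotBr !hb; field.
apply: measurable_funD => //; apply: measurable_funM => //.
exact: measurable_funB.
Qed.

(** Where the coordinate [n_i] is nonzero, [sg n_i * f] equals [n_i * f / sqrt (n_i * n_i)], which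
    involves only sign-independent products. It is applied to the coordinates of the normal and to
    the offset. *)
Lemma measurable_normal_sign (f : plane R -> R) :
  (forall i, measurable_fun setT (fun E => some_normal E 0 i * f E)) ->
  measurable_fun setT (fun E => normal_sign E * f E).
Proof.
move=> mf; pose g i E := some_normal E 0 i * f E /
  Num.sqrt (some_normal E 0 i * some_normal E 0 i).
have mg i : measurable_fun setT (g i).
  apply: measurable_funM => //; apply: measurable_funV.
  exact: measurable_fun_sqrt.
have gE i E : some_normal E 0 i != 0 ->
    Num.sg (some_normal E 0 i) * f E = g i E.
  move=> n0; rewrite /g -expr2 sqrtr_sqr mulrAC; congr (_ * _).
  by rewrite {2}(numEsg (some_normal E 0 i)) mulfK // normr_eq0.
have mz i : measurable_fun setT (fun E => some_normal E 0 i != 0).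
  rewrite (_ : (fun _ => _) =
    fun E => some_normal E 0 i * some_normal E 0 i != 0).
    exact: measurable_neq0.
  by apply/funext => E; rewrite mulf_eq0 orbb.
rewrite (_ : (fun _ => _) = fun E => if some_normal E 0 0 != 0 then g 0 E
  else if some_normal E 0 1 != 0 then g 1 E else g 2 E).
  by apply: measurable_fun_ifT => //; apply: measurable_fun_ifT.
apply/funext => E; rewrite /normal_sign.
case: ifPn => [/gE//|/negPn/eqP h0]; case: ifPn => [/gE//|/negPn/eqP h1].
apply: gE; apply/eqP => h2.
have [+ _] := some_normalP E; rewrite dot3 h0 h1 h2 !mulr0 !addr0 => /eqP.
by rewrite eq_sym oner_eq0.
Qed.

Lemma measurable_normal i : measurable_fun setT (fun E : plane R => normal E 0 i).
Proof.
rewrite (_ : (fun _ => _) = fun E => normal_sign E * some_normal E 0 i).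
  exact: measurable_normal_sign.
by apply/funext => E; rewrite mxE.
Qed.

Lemma measurable_offset : measurable_fun setT (@offset R).
Proof. exact: measurable_normal_sign. Qed.

(** Hitting sets generate, and a plane meets [U] iff it meets a rational ball inside [U]; the latter
    is an inequality between measurable functions of [z]. *)
Lemma measurable_mkplane d (T : measurableType d) (f0 f1 f2 g : T -> R) :
  measurable_fun setT f0 -> measurable_fun setT f1 -> measurable_fun setT f2 ->
  measurable_fun setT g ->
  measurable_fun setT (fun z => mkplane (vec3 (f0 z) (f1 z) (f2 z)) (g z)).
Proof.
move=> m0 m1 m2 mg; pose n z := vec3 (f0 z) (f1 z) (f2 z).
apply: (@measurability _ _ _ _ _ _ (hitting_sets (@plane_set R)) erefl).
move=> _ [_ [U oU <-] <-]; rewrite setTI.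
have mnq q : measurable_fun setT (fun z => dot (n z) q).
  rewrite (_ : (fun _ => _) = fun z =>
    f0 z * q 0 0 + f1 z * q 0 1 + f2 z * q 0 2); last first.
    by apply/funext => z; rewrite dot3 !vec3E.
  by apply: measurable_funD; [apply: measurable_funD|]; apply: measurable_funM.
have mnn : measurable_fun setT (fun z => dot (n z) (n z)).
  rewrite (_ : (fun _ => _) = fun z =>
    f0 z * f0 z + f1 z * f1 z + f2 z * f2 z); last first.
    by apply/funext => z; rewrite dot3 !vec3E.
  by apply: measurable_funD; [apply: measurable_funD|]; apply: measurable_funM.
pose c (b : rat * rat * rat * rat) : 'rV[R]_3 :=
  vec3 (ratr b.1.1.1) (ratr b.1.1.2) (ratr b.1.2).
pose hit b := if `[< 0 < b.2 /\ @rat_ball R b `<=` U >] then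
  [set z | (dot (n z) (c b) - g z) ^+ 2 < ratr b.2 ^+ 2 * dot (n z) (n z)]
  else set0.
have mhit b : measurable (hit b).
  rewrite /hit; case: ifP => _ //.
  rewrite -[X in measurable X]setTI.
  apply: (measurable_fun_ltr (f := fun z => (dot (n z) (c b) - g z) ^+ 2)
    (g := fun z => ratr b.2 ^+ 2 * dot (n z) (n z))) => //.
    by apply: measurable_funX; apply: measurable_funB.
  exact: measurable_funM.
have mN : measurable [set z | dot (n z) (n z) != 0].
  have /(_ measurableT [set true]) := measurable_neq0 mnn.
  by rewrite setTI; exact.
(* Where the normal vanishes the plane is constant, so its contribution is everything or nothing. *)
pose C : set T := [set z | (point : plane R) `&` U !=set0].
have mC : measurable C.
  have [h|h] := pselect ((point : plane R) `&` U !=set0).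
    by rewrite (_ : C = setT) //; apply/seteqP; split.
  by rewrite (_ : C = set0) //; apply/seteqP; split.
rewrite (_ : _ @^-1` _ = ([set z | dot (n z) (n z) != 0] `&` \bigcup_b hit b)
  `|` (~` [set z | dot (n z) (n z) != 0] `&` C)).
  apply: measurableU; apply: measurableI => //; last exact: measurableC.
  by apply: countable_bigcupT_measurable => //; exact: countableP.
have n0 z : (dot (n z) (n z) != 0) = (n z != 0).
  by congr (~~ _); apply/eqP/eqP => [/dot_eq0//|->]; rewrite dot0r.
have hits z : n z != 0 -> (mkplane (n z) (g z) `&` U !=set0) <->
    (\bigcup_b hit b) z.
  move=> nz; rewrite mkplaneE //; split => [[x [hx Ux]]|[b _]].
    have [b [b0 bU xb]] := open_rat_ball oU Ux.
    exists b => //; rewrite /hit; case: ifPn => [_|/asboolPn[]//].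
    by apply/(hplane_hits_ball _ _ _ nz); exists x; split; [exact: hx|exact: xb].
  rewrite /hit; case: ifPn => [/asboolP[b0 bU]|//].
  move/(hplane_hits_ball _ _ _ nz) => [x [hx xb]].
  by exists x; split; [exact: hx|exact: bU].
apply/seteqP; split => z; rewrite /preimage /= n0.
  have [nz|nz] := eqVneq (n z) 0 => h; last by left; split => //; apply/hits.
  by right; split => //; move: h; rewrite -/(n z) nz mkplane0.
case=> [[nz h]|[/negP/negPn/eqP nz h]]; first exact/hits.
by rewrite -/(n z) nz mkplane0.
Qed.

End PlaneMeasurability.

(** * Motions acting on planes *)

Section PlaneAction.
Context {R : realType}.
Implicit Types (u v w n x y : 'rV[R]_3) (M : 'M[R]_3) (E F : plane R).

(** Written in coordinates rather than as an image, so that it is total and jointly measurable in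
    [M], [v] and [E], as Fubini requires. For orthogonal [M] it is the image, by [plact_set]. *)
Definition plact M v E : plane R :=
  mkplane (normal E *m M) (offset E + dot (normal E *m M) v).

Lemma normalM_neq0 M E : orth M -> normal E *m M != 0.
Proof. by move=> hM; apply: dot1_neq0; rewrite orth_dot // normal1. Qed.

Lemma plact_hplane M v E : orth M -> plane_set (plact M v E) =
  hplane (normal E *m M) (offset E + dot (normal E *m M) v).
Proof. by move=> hM; rewrite mkplaneE // normalM_neq0. Qed.

Lemma plact_set M v E : orth M ->
  plane_set (plact M v E) = [set x *m M + v | x in plane_set E].
Proof. by move=> hM; rewrite plact_hplane // (normal_offset E) hplane_image. Qed.

Lemma plactM M M' v v' E : orth M -> orth M' ->
  plact M v (plact M' v' E) = plact (M' *m M) (v' *m M + v) E.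
Proof.
move=> hM hM'; apply: plane_set_inj.
rewrite !plact_set //; last exact: orthM.
apply/seteqP; split => [_ [_ [x hx <-] <-]|_ [x hx <-]].
  by exists x => //; rewrite mulmxDl mulmxA addrA.
exists (x *m M' + v'); first by exists x.
by rewrite mulmxDl mulmxA addrA.
Qed.

Lemma plact1 E : plact 1%:M 0 E = E.
Proof. by rewrite /plact mulmx1 dot0r addr0 mkplaneK. Qed.

Lemma plactK M v E : orth M -> plact M^T (- (v *m M^T)) (plact M v E) = E.
Proof.
by move=> hM; rewrite plactM ?hM ?subrr ?plact1 //; exact: orthT.
Qed.

Lemma plactVK M v E : orth M -> plact M v (plact M^T (- (v *m M^T)) E) = E.
Proof.
move=> hM; have hMT := orthT hM; rewrite plactM // mulNmx orthK // addNr.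
by move: hMT; rewrite /orth trmxK => ->; rewrite plact1.
Qed.

Lemma normal_plact M v E : orth M ->
  normal (plact M v E) = normal E *m M \/
  normal (plact M v E) = - (normal E *m M).
Proof.
move=> hM; have := normal_offset (plact M v E); rewrite plact_hplane //.
by case/hplane_inj => [||[-> _]|[-> _]]; rewrite ?orth_dot ?normal1 //;
  [left|right].
Qed.

Lemma measurable_plact d (T : measurableType d)
    (A : T -> 'M[R]_3) (w : T -> 'rV[R]_3) (E : T -> plane R) :
  (forall i j, measurable_fun setT (fun z => A z i j)) ->
  (forall i, measurable_fun setT (fun z => w z 0 i)) ->
  measurable_fun setT E ->
  measurable_fun setT (fun z => plact (A z) (w z) (E z)).
Proof.
move=> mA mw mE.
have mn i : measurable_fun setT (fun z => normal (E z) 0 i).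
  exact: (measurableT_comp (measurable_normal i) mE).
have mnA i : measurable_fun setT (fun z => (normal (E z) *m A z) 0 i).
  rewrite (_ : (fun _ => _) = fun z => normal (E z) 0 0 * A z 0 i +
    normal (E z) 0 1 * A z 1 i + normal (E z) 0 2 * A z 2 i).
    by apply: measurable_funD; [apply: measurable_funD|]; apply: measurable_funM.
  by apply/funext => z; rewrite mxE sum3.
rewrite (_ : (fun _ => _) = fun z => mkplane
    (vec3 ((normal (E z) *m A z) 0 0) ((normal (E z) *m A z) 0 1)
          ((normal (E z) *m A z) 0 2))
    (offset (E z) + dot (normal (E z) *m A z) (w z))); last first.
  by apply/funext => z; rewrite -vec3_eta.
apply: measurable_mkplane => //; apply: measurable_funD.
  exact: (measurableT_comp measurable_offset mE).
under eq_fun do rewrite dot3.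
by apply: measurable_funD; [apply: measurable_funD|]; apply: measurable_funM.
Qed.

Definition pact M v (E : plane R * plane R) : plane R * plane R :=
  (plact M v E.1, plact M v E.2).

Lemma pactM M M' v v' (E : plane R * plane R) : orth M -> orth M' ->
  pact M v (pact M' v' E) = pact (M' *m M) (v' *m M + v) E.
Proof. by move=> hM hM'; rewrite /pact /= !plactM. Qed.

Lemma pactK M v (E : plane R * plane R) : orth M ->
  pact M^T (- (v *m M^T)) (pact M v E) = E.
Proof. by move=> hM; rewrite /pact /= !plactK //; case: E. Qed.

Lemma measurable_pact d (T : measurableType d)
    (A : T -> 'M[R]_3) (w : T -> 'rV[R]_3) (E : T -> plane R * plane R) :
  (forall i j, measurable_fun setT (fun z => A z i j)) ->
  (forall i, measurable_fun setT (fun z => w z 0 i)) ->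
  measurable_fun setT E ->
  measurable_fun setT (fun z => pact (A z) (w z) (E z)).
Proof.
move=> mA mw mE; apply: measurable_fun_pair.
  by apply: measurable_plact => //; exact: measurableT_comp mE.
by apply: measurable_plact => //; exact: measurableT_comp mE.
Qed.

(** Images under a motion become preimages under its inverse, for which measurability and change of
    variables are available. *)
Lemma moved_plact M v (S : set (plane R)) : orth M ->
  moved (@plane_set R) (fun x => x *m M + v) S =
  plact M^T (- (v *m M^T)) @^-1` S.
Proof.
move=> hM; apply/seteqP; split => [F [E SE hF]|F hF].
  rewrite /preimage /= (_ : F = plact M v E) ?plactK //.
  by apply: plane_set_inj; rewrite plact_set.
by eexists; first exact: hF; rewrite -plact_set // plactVK.
Qed.

Lemma moved_pairs_pact M v (B : set (plane R * plane R)) : orth M ->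
  moved_pairs (fun x => x *m M + v) B = pact M^T (- (v *m M^T)) @^-1` B.
Proof.
move=> hM; apply/seteqP; split => [[F1 F2] [[E1 E2] BE [/= h1 h2]]|F hF].
  rewrite /preimage /= (_ : F1 = plact M v E1); last first.
    by apply: plane_set_inj; rewrite plact_set.
  rewrite (_ : F2 = plact M v E2) /pact /= ?plactK //.
  by apply: plane_set_inj; rewrite plact_set.
eexists; first exact: hF.
by rewrite /= -!plact_set // !plactVK.
Qed.

Lemma plane_measure_plact (nu : {measure set (Gr32 R) -> \bar R})
    (dE : {sigma_finite_measure set (plane R) -> \bar R}) M v S :
  is_plane_measure nu dE -> orth M -> measurable S ->
  dE (plact M v @^-1` S) = dE S.
Proof.
move=> [h _] hM mS; have hMT := orthT hM.
rewrite -(h _ S (affine_isometry (- (v *m M^T)) hMT) mS) moved_plact //.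
by rewrite trmxK mulNmx opprK orthK.
Qed.

End PlaneAction.

(** * Product measures *)

Section ProductMeasures.
Local Open Scope ereal_scope.
Context d1 d2 (T1 : measurableType d1) (T2 : measurableType d2) (R : realType).

(** The section at [x] of the preimage of [B] is the preimage under [tau x] of the section of [B] at
    [S x]; it has the measure of the latter, and [S] preserves the outer integral. The fibre map may
    depend on [x], as it does for motions. *)
Lemma skew_product_preserving (m1 : {measure set T1 -> \bar R})
    (m2 : {sigma_finite_measure set T2 -> \bar R})
    (S : T1 -> T1) (tau : T1 -> T2 -> T2) :
  measurable_fun setT S ->
  measurable_fun setT (fun z : T1 * T2 => tau z.1 z.2) ->
  (forall A, measurable A -> m1 (S @^-1` A) = m1 A) ->
  (forall x A, measurable A -> m2 (tau x @^-1` A) = m2 A) ->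
  forall B, measurable B ->
    (m1 \x m2) ((fun z => (S z.1, tau z.1 z.2)) @^-1` B) = (m1 \x m2) B.
Proof.
move=> mS mtau hS htau B mB; rewrite /product_measure1 /=.
transitivity (\int[m1]_x ((m2 \o xsection B) \o S) x).
  apply: eq_integral => x _ /=.
  rewrite -(htau x (xsection B (S x))); last exact: measurable_xsection.
  by rewrite !xsectionE.
rewrite -(@ge0_integral_pushforward _ _ _ _ _ _ mS _ setT) //.
  by apply: eq_measure_integral => A mA _; exact: hS.
exact: measurable_fun_xsection.
Qed.

(** The measure of the exceptional set is computed by both iterated integrals: one vanishes by
    hypothesis, so almost all sections in the other direction are null. *)
Lemma ae_product_swap (m1 : {sigma_finite_measure set T1 -> \bar R})
    (m2 : {sigma_finite_measure set T2 -> \bar R}) (P : set (T1 * T2)) :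
  measurable P -> {ae m2, forall y, {ae m1, forall x, P (x, y)}} ->
  {ae m1, forall x, {ae m2, forall y, P (x, y)}}.
Proof.
move=> mP h; pose N := ~` P; have mN : measurable N by exact: measurableC.
have N0 : (m1 \x m2) N = 0.
  rewrite (@product_measure_unique _ _ _ _ _ _ _ (m1 \x^ m2)%E) //; last first.
    by move=> A B mA mB; exact: product_measure2E.
  rewrite /product_measure2.
  rewrite -[RHS](integral0 m2 setT); apply: ge0_ae_eq_integral => //.
    exact: measurable_fun_ysection.
  apply: filterS h => y hy _ /=.
  apply/negligibleP; first exact: measurable_ysection.
  apply: negligibleS hy => x; rewrite /ysection /= inE.
  by apply.
have : ae_eq m1 setT (m2 \o xsection N) (cst 0).
  apply/ae_eq_integral_abs => //; first exact: measurable_fun_xsection.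
  by rewrite -[RHS]N0; apply: eq_integral => x _ /=; rewrite gee0_abs.
apply: filterS => x /(_ I) /=.
move/negligibleP => /(_ (measurable_xsection _ mN)).
by apply: negligibleS => y; rewrite /xsection /= inE.
Qed.

Section SigmaFiniteProduct.
Variables (m1 : {sigma_finite_measure set T1 -> \bar R})
  (m2 : {sigma_finite_measure set T2 -> \bar R}).

Lemma product_measure_sigma_finite : sigma_finite setT (m1 \x m2).
Proof.
have /sigma_finiteP[F [TF ndF Foo]] := sigma_finiteT m1.
have /sigma_finiteP[G [TG ndG Goo]] := sigma_finiteT m2.
exists (fun n => F n `*` G n).
  apply/seteqP; split => // -[x y] _.
  have [i _ Fx] : (\bigcup_i F i) x by rewrite -TF.
  have [j _ Gy] : (\bigcup_i G i) y by rewrite -TG.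
  exists (maxn i j) => //; split => /=.
    by move: x Fx; exact/subsetPset/ndF/leq_maxl.
  by move: y Gy; exact/subsetPset/ndG/leq_maxr.
move=> k; have [mF oF] := Foo k; have [mG oG] := Goo k.
split; first exact: measurableX.
by rewrite product_measure1E // lte_mul_pinfty // ge0_fin_numE.
Qed.

(* A sigma-finite structure on [m1 \x m2] is not inferred automatically. *)
Definition sfprod : {sigma_finite_measure set (T1 * T2)%type -> \bar R} :=
  HB.pack_for (SigmaFiniteMeasure.type (T1 * T2)%type R)
    (Measure.sort ((m1 \x m2) : {measure set (T1 * T2)%type -> \bar R}))
    (isSigmaFinite.Build _ _ _ (m1 \x m2) product_measure_sigma_finite)
    (isSFinite.Build _ _ _ (m1 \x m2)
      (sfinite_measure_sigma_finite product_measure_sigma_finite)).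

Lemma sfprod_setT : sfprod setT = m1 setT * m2 setT.
Proof. by rewrite -product_measure1E // setXTT. Qed.

End SigmaFiniteProduct.

End ProductMeasures.

(** * Orthonormal frames *)

Section Frames.
Context {R : realType}.
Implicit Types (u v w n x y : 'rV[R]_3) (M : 'M[R]_3) (E F : plane R).

Definition cross u v : 'rV[R]_3 :=
  vec3 (u 0 1 * v 0 2 - u 0 2 * v 0 1) (u 0 2 * v 0 0 - u 0 0 * v 0 2)
       (u 0 0 * v 0 1 - u 0 1 * v 0 0).

Lemma dot_cross u v : dot (cross u v) (cross u v) =
  dot u u * dot v v - dot u v ^+ 2.
Proof. by rewrite !dot3 !vec3E; ring. Qed.

Lemma dot_crossl u v : dot u (cross u v) = 0.
Proof. by rewrite dot3 !vec3E; ring. Qed.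

Lemma dot_crossr u v : dot v (cross u v) = 0.
Proof. by rewrite dot3 !vec3E; ring. Qed.

(** For unit [u] and [v], the vectors [v - k *: u] and [cross u v] both have squared length
    [1 - k ^+ 2], hence the common factor [s]. *)
Definition gram_schmidt u v (j : 'I_3) : 'rV[R]_3 :=
  let k := dot u v in let s := (Num.sqrt (1 - k ^+ 2))^-1 in
  if j == 0 then u else if j == 1 then s *: (v - k *: u) else s *: cross u v.

Section Unit.
Variables (u v : 'rV[R]_3).
Hypotheses (u1 : dot u u = 1) (v1 : dot v v = 1) (uv : dot u v ^+ 2 != 1).
Let k := dot u v.
Let s := Num.sqrt (1 - k ^+ 2).

Let k1 : 0 < 1 - k ^+ 2.
Proof.
rewrite subr_gt0 lt_neqAle uv /=.
by have := cauchy_schwarz u v; rewrite u1 v1 mulr1.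
Qed.

Let s0 : s != 0.
Proof. by rewrite sqrtr_eq0 -ltNge. Qed.

Let ss : s * s = 1 - k ^+ 2.
Proof. by rewrite -expr2 sqr_sqrtr // ltW. Qed.

Let ssV : s^-1 * (s^-1 * (1 - k ^+ 2)) = 1.
Proof. by rewrite -ss mulrA -invfM mulVf // mulf_neq0. Qed.

Lemma gram_schmidt_orthonormal i j :
  dot (gram_schmidt u v i) (gram_schmidt u v j) = (i == j)%:R.
Proof.
have h01 : dot u (v - k *: u) = 0 by rewrite dotBr dotZr u1 mulr1 subrr.
have h12 : dot (v - k *: u) (cross u v) = 0.
  by rewrite dotBl dotZl dot_crossl dot_crossr mulr0 subrr.
have h11 : dot (v - k *: u) (v - k *: u) = 1 - k ^+ 2.
  by rewrite {1}dotBl dotZl h01 mulr0 subr0 dotBr dotZr v1 dotC.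
have h22 : dot (cross u v) (cross u v) = 1 - k ^+ 2.
  by rewrite dot_cross u1 v1 mulr1.
move: i j; apply: ord3P; apply: ord3P; rewrite /gram_schmidt /= -/k -/s
  ?dotZr ?dotZl ?(dotC _ u) ?(dotC (cross u v) (v - _)) ?h01 ?h12 ?h11 ?h22
  ?dot_crossl ?u1 ?mulr0 //.
Qed.

Lemma gram_schmidt_orth : orth (\matrix_i gram_schmidt u v i).
Proof.
by apply: orth_rows => i j; rewrite !rowK gram_schmidt_orthonormal.
Qed.

End Unit.

Definition sgb (b : bool) : R := (-1) ^+ b.

Lemma sgb2 b : sgb b * sgb b = 1.
Proof. by rewrite /sgb -expr2 sqrr_sign. Qed.

Lemma sgbP (c : R) : c ^+ 2 = 1 -> exists b, c = sgb b.
Proof.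
move/eqP; rewrite sqrf_eq1 => /orP[]/eqP ->; first by exists false.
by exists true.
Qed.

(** The first two axes are computed directly. The third is a unit vector orthogonal to them, so it
    is determined up to sign; this avoids tracking the determinant of [M]. *)
Lemma gram_schmidt_mul u v M a b : dot u u = 1 -> dot v v = 1 ->
  dot u v ^+ 2 != 1 -> orth M -> forall j, exists c,
  gram_schmidt (sgb a *: (u *m M)) (sgb b *: (v *m M)) j =
    sgb c *: (gram_schmidt u v j *m M).
Proof.
move=> u1 v1 uv hM; set u' := sgb a *: _; set v' := sgb b *: _.
have u1' : dot u' u' = 1 by rewrite dotZl dotZr mulrA sgb2 mul1r orth_dot.
have v1' : dot v' v' = 1 by rewrite dotZl dotZr mulrA sgb2 mul1r orth_dot.
have kE : dot u' v' = sgb a * sgb b * dot u v.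
  by rewrite dotZl dotZr orth_dot // mulrA.
have k2 : dot u' v' ^+ 2 = dot u v ^+ 2.
  by rewrite kE exprMn exprMn !expr2 !sgb2 !mul1r.
have h0 : gram_schmidt u' v' 0 = sgb a *: (gram_schmidt u v 0 *m M) by [].
have h1 : gram_schmidt u' v' 1 = sgb b *: (gram_schmidt u v 1 *m M).
  rewrite /gram_schmidt /= k2 -scalemxAl scalerA mulrC -scalerA.
  congr (_ *: _); rewrite kE mulmxBl -scalemxAl scalerBr /u' !scalerA.
  congr (_ - _ *: _); transitivity (sgb a * sgb a * (sgb b * dot u v)).
    by ring.
  by rewrite sgb2 mul1r.
apply: ord3P; [by exists a|by exists b|].
have uv' : dot u' v' ^+ 2 != 1 by rewrite k2.
have hg := gram_schmidt_orthonormal u1 v1 uv.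
have hg' := gram_schmidt_orthonormal u1' v1' uv'.
have hG : orth (\matrix_i gram_schmidt u v i *m M).
  by apply: orthM => //; exact: gram_schmidt_orth.
pose f := gram_schmidt u v 2 *m M; pose g := gram_schmidt u' v' 2.
have gE : g = dot g f *: f.
  apply: (orth_ext hG) => i; rewrite row_mul rowK dotZl /f orth_dot // hg.
  move: i; apply: ord3P; rewrite ?mulr0 ?mulr1 //.
    have := hg' 2 0; rewrite h0 dotZr => /eqP.
    by rewrite mulf_eq0 /sgb signr_eq0 => /eqP.
  have := hg' 2 1; rewrite h1 dotZr => /eqP.
  by rewrite mulf_eq0 /sgb signr_eq0 => /eqP.
have [c hc] : exists c, dot g f = sgb c.
  apply: sgbP; have := hg' 2 2; rewrite -/g {1}gE dotZl dotC -expr2.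
  by move=> ->.
by exists c; rewrite -hc -gE.
Qed.

Definition nonpar (E : plane R * plane R) : bool :=
  dot (normal E.1) (normal E.2) ^+ 2 != 1.

(* A frame depending equivariantly on a pair of planes exists only up to the
   directions of its axes, hence the free signs [e]; see [frame_pact]. *)
Definition frame (e : {ffun 'I_3 -> bool}) (E : plane R * plane R) : 'M[R]_3 :=
  \matrix_(i, j) (sgb (e j) * gram_schmidt (normal E.1) (normal E.2) j 0 i).

Lemma frame_orth e (E : plane R * plane R) : nonpar E -> orth (frame e E).
Proof.
move=> hE; rewrite -[frame e E]trmxK; apply: orthT; apply: orth_rows => i j.
have h k : row k (frame e E)^T =
    sgb (e k) *: gram_schmidt (normal E.1) (normal E.2) k.
  by apply/rowP => l; rewrite !mxE.
rewrite !h dotZl dotZr gram_schmidt_orthonormal ?normal1 // mulrA.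
by have [->|] := eqVneq i j; rewrite ?mulr0 // sgb2 mulr1.
Qed.

Lemma normal_plact_sgb M v E : orth M ->
  exists b, normal (plact M v E) = sgb b *: (normal E *m M).
Proof.
case/(normal_plact v E) => ->; first by exists false; rewrite /sgb scale1r.
by exists true; rewrite /sgb scaleN1r.
Qed.

(** The axes are the columns of the frame, so [M] on the left moves each of them by [M^T], as
    [pact M^T v] moves the normals. The signs from [normal] and from [gram_schmidt_mul] are
    collected in [e']. *)
Lemma frame_pact M v e (E : plane R * plane R) : orth M -> nonpar E ->
  exists e', M *m frame e E = frame e' (pact M^T v E).
Proof.
move=> hM hE; have hMT := orthT hM; rewrite /frame /pact /=.
have [a ->] := normal_plact_sgb v E.1 hMT.
have [b ->] := normal_plact_sgb v E.2 hMT.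
have /fin_all_exists[c hc] :=
  gram_schmidt_mul a b (normal1 E.1) (normal1 E.2) hE hMT.
exists [ffun j => e j (+) c j]; apply/matrixP => i j.
transitivity (sgb (e j) *
    (gram_schmidt (normal E.1) (normal E.2) j *m M^T) 0 i).
  by rewrite !mxE mulr_sumr; apply: eq_bigr => l _; rewrite !mxE; ring.
rewrite [RHS]mxE ffunE hc [in RHS]mxE mulrA; congr (_ * _).
by rewrite {2}/sgb signr_addb -mulrA -/(sgb _) -/(sgb _) sgb2 mulr1.
Qed.

Lemma measurable_dot_normal d (T : measurableType d) (E F : T -> plane R) :
  measurable_fun setT E -> measurable_fun setT F ->
  measurable_fun setT (fun z => dot (normal (E z)) (normal (F z))).
Proof.
move=> mE mF; under eq_fun do rewrite dot3.
have mn i : measurable_fun setT (fun z => normal (E z) 0 i).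
  exact: (measurableT_comp (measurable_normal i) mE).
have mm i : measurable_fun setT (fun z => normal (F z) 0 i).
  exact: (measurableT_comp (measurable_normal i) mF).
by apply: measurable_funD; [apply: measurable_funD|]; apply: measurable_funM.
Qed.

Lemma measurable_frame e i j :
  measurable_fun setT (fun E : plane R * plane R => frame e E i j).
Proof.
pose n1 i (E : plane R * plane R) := normal E.1 0 i.
pose n2 i (E : plane R * plane R) := normal E.2 0 i.
have m1 l : measurable_fun setT (n1 l).
  by apply: (measurableT_comp (measurable_normal l)).
have m2 l : measurable_fun setT (n2 l).
  by apply: (measurableT_comp (measurable_normal l)).
have md : measurable_fun setT
    (fun E : plane R * plane R => dot (normal E.1) (normal E.2)).
  exact: measurable_dot_normal.
under eq_fun do rewrite mxE.
apply: measurable_funM => //.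
have ms : measurable_fun setT (fun E : plane R * plane R =>
    (Num.sqrt (1 - dot (normal E.1) (normal E.2) ^+ 2))^-1).
  apply: measurable_funV; apply: measurable_fun_sqrt.
  by apply: measurable_funB; [exact: measurable_cst|exact: measurable_funX].
move: j; apply: ord3P; rewrite /gram_schmidt /=.
- exact: m1.
- have he (s k : R) u v : (s *: (v - k *: u)) 0 i = s * (v 0 i - k * u 0 i).
    by rewrite !mxE.
  under eq_fun do rewrite he.
  apply: measurable_funM => //; apply: measurable_funB; first exact: m2.
  by apply: measurable_funM => //; exact: m1.
- under eq_fun do rewrite mxE.
  apply: measurable_funM => //.
  have mc a b : measurable_fun setT (fun E : plane R * plane R =>
      n1 a E * n2 b E - n1 b E * n2 a E).
    by apply: measurable_funB; apply: measurable_funM.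
  move: i; apply: ord3P.
  + by under eq_fun do rewrite vec3E; exact: mc.
  + by under eq_fun do rewrite vec3E; exact: mc.
  + by under eq_fun do rewrite vec3E; exact: mc.
Qed.

End Frames.

(** * Pairs of parallel planes are negligible *)

Section NullSets.
Context {R : realType}.
Implicit Types (u v w n x y : 'rV[R]_3) (M : 'M[R]_3) (W : Gr32 R).

Lemma open_hplaneC n (d : R) : open (~` hplane n d).
Proof.
have cf : continuous (dot n).
  rewrite (_ : dot n = fun x => n 0 0 * x 0 0 + n 0 1 * x 0 1 + n 0 2 * x 0 2);
    last by apply/funext => x; rewrite dot3.
  move=> x; have mm (i : 'I_3) :
      (fun y : 'rV[R]_3 => n 0 i * y 0 i) @ nbhs x --> n 0 i * x 0 i.
    by apply: (@cvgM _ _ (nbhs x));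
      [exact: cvg_cst|exact: (@coord_continuous R _ _ 0 i x)].
  by apply: (@cvgD _ _ _ (nbhs x)) (mm 2); apply: (@cvgD _ _ _ (nbhs x)).
rewrite (_ : ~` _ = dot n @^-1` [set t | t != d]).
  exact: (open_comp (fun x _ => cf x) (@open_neq R d)).
by apply/seteqP; split => x /= /eqP.
Qed.

(** By equality of dimensions, a plane other than [W] leaves [W], so it meets the open complement of
    [W]. *)
Lemma measurable_Gr_set1 W : measurable [set W].
Proof.
have [n [n1 hn]] := lin_set_hplane W.
rewrite -[X in measurable X]setCK; apply: measurableC.
rewrite (_ : ~` [set W] =
    [set W' : Gr32 R | lin_set W' `&` ~` hplane n 0 !=set0]).
  apply: sub_sigma_algebra.
  by exists (~` hplane n 0); [exact: open_hplaneC|].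
apply/seteqP; split => W' /=; last first.
  by case=> x [+ +] e; rewrite e hn.
move=> WW'; apply: contrapT => h; apply: WW'; apply: lin_set_inj.
rewrite hn; apply: lin_set_perp; first exact: dot1_neq0.
move=> w hw; apply: contrapT => nw; apply: h; exists w; split => //.
Qed.

Lemma unit_dot2 u v : dot u u = 1 -> dot v v = 1 -> dot u v ^+ 2 = 1 ->
  v = u \/ v = - u.
Proof.
move=> u1 v1 k2; have : dot (v - dot u v *: u) (v - dot u v *: u) = 0.
  rewrite !(dotBl, dotBr, dotZl, dotZr) u1 v1 (dotC v u) mulr1 subrr mulr0.
  by rewrite subr0 -expr2 k2 subrr.
move/dot_eq0/eqP; rewrite subr_eq0 => /eqP ->.
move/eqP: k2; rewrite sqrf_eq1 => /orP[]/eqP ->; first by left; rewrite scale1r.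
by right; rewrite scaleN1r.
Qed.

Lemma hplane0N n : hplane (- n) 0 = hplane n 0 :> set 'rV[R]_3.
Proof. by rewrite -[RHS]hplaneN oppr0. Qed.

(** The reflection in the plane orthogonal to [m]; for [m = 0] it is the identity. *)
Definition reflect m x := x - (2 * dot x m / dot m m) *: m.

Lemma reflect_isometry m : isometry3 (reflect m).
Proof.
move=> x y; apply/enormE; rewrite /reflect; have [m0|m0] := eqVneq (dot m m) 0.
  by rewrite m0 invr0 !mulr0 !scale0r !subr0.
have -> : x - (2 * dot x m / dot m m) *: m - (y - (2 * dot y m / dot m m) *: m)
    = (x - y) - (2 * dot (x - y) m / dot m m) *: m.
  by apply/rowP => i; rewrite dotBl !mxE; ring.
move: (x - y) => z; rewrite !(dotBl, dotBr, dotZl, dotZr) (dotC m z).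
by field.
Qed.

Lemma reflectE u v : dot u u = 1 -> dot v v = 1 -> reflect (u - v) u = v.
Proof.
move=> u1 v1; rewrite /reflect; have [uv|uv] := eqVneq (dot (u - v) (u - v)) 0.
  have /eqP := dot_eq0 uv; rewrite subr_eq0 => /eqP ->.
  by rewrite subrr scaler0 subr0.
have -> : 2 * dot u (u - v) / dot (u - v) (u - v) = 1.
  rewrite (_ : 2 * dot u (u - v) = dot (u - v) (u - v)) ?divff //.
  by rewrite !(dotBl, dotBr) (dotC v u) u1 v1; ring.
by rewrite scale1r opprB addrC subrK.
Qed.

Section Grassmann.
Variable nu : {measure set (Gr32 R) -> \bar R}.
Hypothesis hnu : is_grassmann_measure nu.

(** The reflection along the difference of the unit normals fixes the origin and carries [W'] to
    [W]. *)
Lemma grassmann_set1_eq W W' : nu [set W] = nu [set W'].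
Proof.
have [u [u1 hu]] := lin_set_hplane W; have [v [v1 hv]] := lin_set_hplane W'.
have g0 : reflect (v - u) 0 = 0.
  by rewrite /reflect dotC dot0r mulr0 mul0r scale0r subrr.
rewrite -(hnu.1 _ _ (reflect_isometry (v - u)) g0 (measurable_Gr_set1 W')).
congr (nu _).
have [M [hM hg]] := isometry_affine (reflect_isometry (v - u)).
have e : [set reflect (v - u) x | x in lin_set W'] = lin_set W.
  rewrite hu hv (_ : reflect (v - u) = fun x => x *m M + 0); last first.
    by apply/funext => x; rewrite hg g0.
  rewrite hplane_image // dot0r addr0; congr (hplane _ _).
  by rewrite -(reflectE v1 u1) hg g0 addr0.
apply/seteqP; split => [_ ->|V [_ -> h]]; first by exists W' => //; rewrite e.
by apply: lin_set_inj; rewrite h e.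
Qed.

(** All points have the same mass, there are infinitely many of them, and the total mass is
    finite. *)
Lemma grassmann_set1 W : nu [set W] = 0%E.
Proof.
have hV (k : nat) : vec3 1 k%:R 0 != 0 :> 'rV[R]_3.
  by apply/eqP => /rowP/(_ 0); rewrite !mxE => /eqP; rewrite oner_eq0.
pose V k := projT1 (cid (linear_plane_ex (hV k))).
have VE k : lin_set (V k) = hplane (vec3 1 k%:R 0) 0.
  exact: projT2 (cid (linear_plane_ex (hV k))).
have Vinj : injective V.
  (* The vector [(-j, 1, 0)] lies in [V j], and it lies in [V k] only if [j = k]. *)
  move=> j k e; have : hplane (vec3 1 k%:R 0) 0 (vec3 (- j%:R) 1 0 : 'rV[R]_3).
    rewrite -VE -e VE /hplane /= dot3 !vec3E; ring.
  rewrite /hplane /= dot3 !vec3E mul1r !mulr1 mulr0 addr0 addrC => /eqP.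
  by rewrite subr_eq0 eqr_nat => /eqP.
have tV : trivIset setT (fun k => [set V k]).
  by move=> i j _ _ [x [/= -> /Vinj ->]].
have le (k : nat) : (\sum_(i < k) nu [set W] <= (2 * pi)%:E)%E.
  rewrite -hnu.2; apply: (@le_trans _ _ (nu (\bigcup_k [set V k]))); last first.
    apply: le_measure; rewrite ?inE //.
    by apply: bigcupT_measurable => j; exact: measurable_Gr_set1.
  rewrite measure_bigcup //; last by move=> j _; exact: measurable_Gr_set1.
  under eq_eseriesr do rewrite (grassmann_set1_eq _ W).
  rewrite -(big_mkord xpredT (fun=> nu [set W])).
  apply: le_trans (nneseries_lim_ge k _); last by move=> *; exact: measure_ge0.
  rewrite le_eqVlt; apply/orP; left.
  by apply/eqP/esym/eq_bigl => j; rewrite in_setT.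
have c0 : (0 <= nu [set W])%E := measure_ge0 _ _.
have := le 1%N; rewrite big_ord1; move: le c0.
case: (nu [set W]) => [r le|//|//]; rewrite lee_fin le_eqVlt.
case/orP => [/eqP <- //|r0] _; exfalso.
have := le (Num.bound (2 * pi / r)).
rewrite sumEFin big_const_ord iter_addr_0 lee_fin -(mulr_natl r) leNgt.
rewrite -ltr_pdivrMr // archi_boundP //.
by rewrite divr_ge0 // ?mulr_ge0 // ?pi_ge0 // ltW.
Qed.

Section PlaneMeasure.
Variable dE : {sigma_finite_measure set (plane R) -> \bar R}.
Hypothesis hdE : is_plane_measure nu dE.

Lemma measurable_par : measurable [set E : plane R * plane R | ~~ nonpar E].
Proof.
have m2 : measurable_fun setT
    (fun E : plane R * plane R => dot (normal E.1) (normal E.2) ^+ 2).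
  by apply: measurable_funX; apply: measurable_dot_normal.
have /(_ measurableT [set true]) :=
  measurable_fun_eqr m2 (measurable_cst (1 : R)).
rewrite setTI /preimage => h.
rewrite (_ : [set _ | _] =
  [set E | (dot (normal E.1) (normal E.2) ^+ 2 == 1) = true]); first exact: h.
by apply/seteqP; split => E /=; rewrite /nonpar negbK.
Qed.

(** In the disintegration of [dE] the inner integral vanishes except at the direction [W] of [E1].
    Its value there does not matter, because [nu [set W] = 0]. *)
Lemma plane_measure_par (E1 : plane R) :
  dE [set E | ~~ nonpar (E1, E)] = 0%E.
Proof.
set A := [set E | _]; have mA : measurable A.
  by have := measurable_xsection E1 measurable_par; rewrite xsectionE.
have [W hW] := linear_plane_ex (normal_neq0 E1).
rewrite -(setIT A) -integral_indic // hdE.2; last 2 first.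
- by apply/measurable_EFinP.
- by move=> E; rewrite lee_fin.
pose h E0 := perp_integral E0 (fun p => (\1_A (translate E0 p) : R)%:E).
have hE : h = (cst (h W)) \_ [set W].
  apply/funext => E0; rewrite patchE; case: ifPn => [|/negP nW].
    by rewrite inE => ->.
  rewrite /h /perp_integral integral0_eq // => t _.
  rewrite indicE; case: (boolP (_ \in A)) => [|//].
  rewrite inE /A /= /nonpar negbK /= => /eqP par.
  exfalso; apply: nW; rewrite inE /=; apply: lin_set_inj.
  have [m [m1 hm]] := lin_set_hplane E0; rewrite hm hW.
  set E := translate _ _ in par.
  have := normal_offset E; rewrite (translate_hplane _ hm).
  have [nE|nE] := unit_dot2 (normal1 E1) (normal1 E) par.
    by case/hplane_inj => [||[e _]|[e _]];
      rewrite ?normal1 // -nE e ?hplane0N.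
  by case/hplane_inj => [||[e _]|[e _]]; rewrite ?normal1 //
    -[RHS]hplane0N -nE e ?hplane0N.
rewrite -/h hE -integral_mkcond null_set_integral //.
  exact: measurable_Gr_set1.
exact: grassmann_set1.
Qed.

Lemma ae_nonpar : {ae (dE \x dE)%E, forall E, nonpar E}.
Proof.
have mN := measurable_par.
exists [set E | ~~ nonpar E]; split => //; last by move=> E /= /negP.
rewrite /= /product_measure1 integral0_eq // => E1 _ /=.
rewrite -[RHS](plane_measure_par E1); congr (dE _).
by apply/seteqP; split => E; rewrite /xsection /= inE.
Qed.

End PlaneMeasure.
End Grassmann.

End NullSets.

(** * Translation invariance *)

Section LebesgueShift.
Context {R : realType}.

Local Notation leb := (@lebesgue_measure R).

Lemma lebesgue_shift (a : R) (A : set R) : measurable A ->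
  leb ((fun x => x + a) @^-1` A) = leb A.
Proof.
move=> mA; have ms : measurable_fun setT
    ((fun x => x + a) : measurableTypeR R -> measurableTypeR R).
  exact: measurable_funD.
pose sh : {mfun measurableTypeR R >-> measurableTypeR R} :=
  @mfun_Sub _ _ (measurableTypeR R) (measurableTypeR R) _ (mem_set ms).
apply/esym; apply: (@lebesgue_measure_unique R (pushforward leb sh)) => //.
move=> _ [[b c] _ <-].
transitivity (leb `]b - a, c - a]%classic); last first.
  congr (leb _); apply/seteqP.
  by split => x /=; rewrite !in_itv /= ltrBlDr lerBrDr.
rewrite /= !lebesgue_measure_itv /= !lte_fin ltrD2r; case: ifP => // _.
by rewrite -!EFinB; congr (_%:E); ring.
Qed.

Local Notation mR := (measurableTypeR R).

Definition leb3 : {sigma_finite_measure set (mR * mR * mR)%type -> \bar R} :=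
  sfprod (sfprod leb leb) leb.

Definition vec (t : mR * mR * mR) : 'rV[R]_3 := vec3 t.1.1 t.1.2 t.2.

Definition shift3 (w : 'rV[R]_3) (t : mR * mR * mR) : mR * mR * mR :=
  (t.1.1 + w 0 0, t.1.2 + w 0 1, t.2 + w 0 2).

Lemma vec_shift3 w t : vec (shift3 w t) = vec t + w.
Proof. by apply: row3P; rewrite [RHS]mxE /vec !vec3E. Qed.

Lemma measurable_shift (a : R) :
  measurable_fun setT ((fun x => x + a) : mR -> mR).
Proof. exact: measurable_funD. Qed.

Lemma leb3_shift w (A : set (mR * mR * mR)) : measurable A ->
  leb3 (shift3 w @^-1` A) = leb3 A.
Proof.
move=> mA; have ms := measurable_shift.
apply: (@skew_product_preserving _ _ _ _ _ (sfprod leb leb) leb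
  (fun t : mR * mR => (t.1 + w 0 0, t.2 + w 0 1) : mR * mR)
  (fun _ x => x + w 0 2 : mR)) => //.
- apply: measurable_fun_pair.
    exact: (measurableT_comp (ms _) measurable_fst).
  exact: (measurableT_comp (ms _) measurable_snd).
- exact: (measurableT_comp (ms _) measurable_snd).
- move=> B mB; apply: (@skew_product_preserving _ _ _ _ _ leb leb
    (fun x => x + w 0 0 : mR) (fun _ x => x + w 0 1 : mR)) => //.
  + exact: (measurableT_comp (ms _) measurable_snd).
  + by move=> C mC; exact: lebesgue_shift.
  + by move=> _ C mC; exact: lebesgue_shift.
- by move=> _ C mC; exact: lebesgue_shift.
Qed.

End LebesgueShift.

(** * Invariance of the density *)

Section MeasurePreserving.
Local Open Scope ereal_scope.
Context d (T : measurableType d) (R : realType).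
Variables (mu : {measure set T -> \bar R}) (phi : T -> T).
Hypotheses (mphi : measurable_fun setT phi)
  (phi_mu : forall A, measurable A -> mu (phi @^-1` A) = mu A).

Lemma measurable_preimage A : measurable A -> measurable (phi @^-1` A).
Proof. by move=> mA; rewrite -[X in measurable X]setTI; exact: mphi. Qed.

Lemma ge0_integral_preserving D (f : T -> \bar R) : measurable D ->
  measurable_fun setT f -> (forall x, 0 <= f x) ->
  \int[mu]_(x in phi @^-1` D) f (phi x) = \int[mu]_(x in D) f x.
Proof.
move=> mD mf f0; rewrite -(@ge0_integral_pushforward _ _ _ _ _ _ mphi _ D f) //.
- by apply: eq_measure_integral => A mA _; exact: phi_mu.
- exact: measurable_funTS.
Qed.

Lemma integral_preserving D (f : T -> R) : measurable D ->
  measurable_fun setT f ->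
  \int[mu]_(x in phi @^-1` D) (f (phi x))%:E = \int[mu]_(x in D) (f x)%:E.
Proof.
move=> mD mf; have mF : measurable_fun setT (EFin \o f) by exact/measurable_EFinP.
rewrite integralE [RHS]integralE; congr (_ - _).
- have h := ge0_integral_preserving mD (measurable_funepos mF)
    (fun=> funepos_ge0 _ _).
  by apply: etrans h; apply: eq_integral => x _; rewrite !funeposE.
- have h := ge0_integral_preserving mD (measurable_funeneg mF)
    (fun=> funeneg_ge0 _ _).
  by apply: etrans h; apply: eq_integral => x _; rewrite !funenegE.
Qed.

Lemma ae_preserving (P : T -> Prop) :
  {ae mu, forall x, P x} -> {ae mu, forall x, P (phi x)}.
Proof.
case=> N [mN N0 PN]; exists (phi @^-1` N); split.
- exact: measurable_preimage.
- by rewrite phi_mu.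
- by move=> x /= Px; apply: PN.
Qed.

End MeasurePreserving.

(** Integrability is not assumed. The functions are compared on sets of finite measure where
    [|f| < k], which exhaust the space. *)
Lemma ae_eq_of_integral d (T : measurableType d) (R : realType)
    (mu : {sigma_finite_measure set T -> \bar R}) (f g : T -> R) :
  measurable_fun setT f -> measurable_fun setT g ->
  (forall A, measurable A ->
    (\int[mu]_(x in A) (f x)%:E = \int[mu]_(x in A) (g x)%:E)%E) ->
  {ae mu, forall x, f x = g x}.
Proof.
move=> mf mg fg; have /sigma_finiteP[F [FT Fnd Foo]] := sigma_finiteT mu.
pose D k := F k `&` [set x | `|f x| < k%:R].
have mD k : measurable (D k).
  apply: measurableI; first by have [] := Foo k.
  apply: measurable_lt => //; exact: measurableT_comp.
suff : {ae mu, forall x, forall k, D k x -> (f x)%:E = (g x)%:E}.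
  apply: filterS => x h; apply: EFin_inj.
  have [k _ Fx] : (\bigcup_k F k) x by rewrite -FT.
  pose l := maxn k (Num.bound `|f x|); apply: (h l); split.
    by have /subsetPset := Fnd k l (leq_maxl _ _); apply.
  apply: lt_le_trans (archi_boundP (normr_ge0 _)) _.
  by rewrite ler_nat leq_maxr.
apply: ae_foralln => k; apply: integral_ae_eq => //.
- apply: measurable_bounded_integrable => //.
  + apply: le_lt_trans (Foo k).2; apply: le_measure; rewrite ?inE //.
      by have [] := Foo k.
    exact: subIsetl.
  + exact: measurable_funTS.
  + exists k%:R; split => // M kM x [_ /= fx]; exact/ltW/(lt_trans fx).
- exact/measurable_EFinP/measurable_funTS.
- by move=> A _ mA; exact: fg.
Qed.

(** * Invariance of the density measure as almost sure invariance of the density *)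

Section PlanePairs.
Context {R : realType}.
Variables (nu : {measure set (Gr32 R) -> \bar R})
  (dE : {sigma_finite_measure set (plane R) -> \bar R}).
Hypothesis hdE : is_plane_measure nu dE.
Implicit Types (M : 'M[R]_3) (v : 'rV[R]_3).

Lemma measurable_pact_cst M v : measurable_fun setT (pact M v).
Proof.
by apply: (@measurable_pact _ _ _ (fun=> M) (fun=> v) id) => *;
  [exact: measurable_cst|exact: measurable_cst|exact: measurable_id].
Qed.

Lemma pact_preserving M v (A : set (plane R * plane R)) : orth M ->
  measurable A -> (dE \x dE)%E (pact M v @^-1` A) = (dE \x dE)%E A.
Proof.
move=> hM mA; have mp : measurable_fun setT (plact M v).
  by apply: (@measurable_plact _ _ _ (fun=> M) (fun=> v) id) => *;
    [exact: measurable_cst|exact: measurable_cst|exact: measurable_id].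
apply: (@skew_product_preserving _ _ _ _ _ dE dE (plact M v)
  (fun _ => plact M v)) => //.
- exact: (measurableT_comp mp measurable_snd).
- by move=> S mS; exact: plane_measure_plact hdE hM mS.
- by move=> _ S mS; exact: plane_measure_plact hdE hM mS.
Qed.

(** Motions preserve [dE \x dE], so integrating [ft] over the image of a set is integrating [ft]
    composed with the motion over the set itself. Invariance thus compares two functions through
    their integrals on all measurable sets. *)
Lemma isometry_invariant_ae (ft : plane R * plane R -> R) :
  measurable_fun setT ft ->
  isometry_invariant (density_measure dE ft) <->
  forall M v, orth M -> {ae (dE \x dE)%E, forall E, ft (pact M v E) = ft E}.
Proof.
move=> mft; split => [hinv M v hM|hae g B hg mB].
  have hMT := orthT hM; have mp := measurable_pact_cst M v.
  apply: (@ae_eq_of_integral _ _ _ (sfprod dE dE)) => //.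
    exact: measurableT_comp.
  move=> A mA.
  pose S := pact M^T (- (v *m M^T)) @^-1` A.
  have mS : measurable S.
    by apply: measurable_preimage => //; exact: measurable_pact_cst.
  have AS : A = pact M v @^-1` S.
    by apply/seteqP; split => E; rewrite /S /preimage /= pactK.
  transitivity (\int[dE \x dE]_(E in S) (ft E)%:E)%E.
    rewrite {1}AS; apply: (integral_preserving (mu := (dE \x dE)%E)) => //.
    by move=> C mC; exact: pact_preserving.
  have := hinv _ A (affine_isometry v hM) mA.
  by rewrite moved_pairs_pact.
have [M [hM gE]] := isometry_affine hg; have hMT := orthT hM.
rewrite (_ : g = fun x => x *m M + g 0); last exact/funext.
rewrite moved_pairs_pact // /density_measure; set w := - _.
have mp := measurable_pact_cst M^T w.
have mS : measurable (pact M^T w @^-1` B) by exact: measurable_preimage.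
rewrite -[RHS](@integral_preserving _ _ _ _ _ mp) //; last first.
  by move=> C mC; exact: pact_preserving.
apply: ae_eq_integral => //.
- exact/measurable_EFinP/measurable_funTS.
- by apply/measurable_EFinP/measurable_funTS; exact: measurableT_comp.
- by apply: filterS (hae M^T w hMT) => E hE _; rewrite hE.
Qed.

End PlanePairs.

(** * Recovering the function of the angle *)

Section SigmaFinite.
Local Open Scope ereal_scope.
Context d (T : measurableType d) (R : realType).
Variable mu : {sigma_finite_measure set T -> \bar R}.

Lemma sigma_finite_piece : mu setT != 0 ->
  exists A, [/\ measurable A, mu A != 0 & mu A < +oo].
Proof.
move=> mu0; have /sigma_finiteP[F [FT _ Foo]] := sigma_finiteT mu.
apply: contrapT => h; move/negP: mu0; apply; apply/eqP.
apply/negligibleP => //; rewrite FT; apply: negligible_bigcup => k.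
have [mF Fy] := Foo k; apply/negligibleP => //; apply: contrapT => F0.
by apply: h; exists (F k); split => //; apply/eqP.
Qed.

(** For nonnegative [q] Tonelli gives measurability of the average in [s] without integrability;
    when [q (s, -)] is almost surely [c] the integral over [A] is [c * mu A]. *)
Lemma ge0_ae_constant_value d' (S : measurableType d') (q : S * T -> R) :
  mu setT != 0 -> measurable_fun setT q -> (forall z, 0 <= q z)%R ->
  exists2 f : S -> R, measurable_fun setT f &
    forall s c, {ae mu, forall y, q (s, y) = c} -> f s = c.
Proof.
move=> mu0 mq q0; have [A [mA A0 Ay]] := sigma_finite_piece mu0.
pose g (z : S * T) := (q z * \1_A z.2)%:E.
have mg : measurable_fun setT g.
  apply/measurable_EFinP; apply: measurable_funM => //.
  exact: (measurableT_comp (measurable_indic mA) measurable_snd).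
have g0 z : 0 <= g z by rewrite lee_fin mulr_ge0.
have mF : measurable_fun setT (fun s => \int[mu]_y g (s, y)).
  exact: measurable_fun_fubini_tonelli_F.
exists (fun s => fine (\int[mu]_y g (s, y)) / fine (mu A))%R.
  by apply: measurable_funM => //; exact: measurableT_comp mF.
move=> s c h.
have muA : mu A \is a fin_num by rewrite ge0_fin_numE.
have -> : \int[mu]_y g (s, y) = (c * fine (mu A))%:E.
  have mcA : measurable_fun setT ((cst c%:E : T -> \bar R) \_ A).
    by apply/(measurable_restrictT _ mA)/measurable_cst.
  rewrite (@ae_eq_integral _ _ _ mu setT ((cst c%:E) \_ A)) //.
  - by rewrite -integral_mkcond integral_cst // EFinM fineK.
  - exact: measurable_fun_pair2.
  - apply: filterS h => y hy _; rewrite /g /= hy patchE indicE.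
    by case: ifP => _; rewrite ?mulr1 ?mulr0.
by rewrite /= mulfK // fine_eq0.
Qed.

(* Averaging over a piece of finite positive measure recovers, measurably in
   [s], the almost sure value of [q (s, -)] whenever there is one. *)
Lemma ae_constant_value d' (S : measurableType d') (q : S * T -> R) :
  mu setT != 0 -> measurable_fun setT q ->
  exists2 f : S -> R, measurable_fun setT f &
    forall s c, {ae mu, forall y, q (s, y) = c} -> f s = c.
Proof.
move=> mu0 mq.
(* Positive and negative parts are averaged separately, since [q] itself may fail to be
   integrable. *)
have [||f1 mf1 h1] := @ge0_ae_constant_value _ _ (fun z => Num.max (q z) 0)%R mu0.
- exact: measurable_maxr.
- by move=> z; rewrite le_max lexx orbT.
have [||f2 mf2 h2] := @ge0_ae_constant_value _ _
    (fun z => Num.max (- q z) 0)%R mu0.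
- by apply: measurable_maxr => //; exact: measurableT_comp.
- by move=> z; rewrite le_max lexx orbT.
exists (fun s => f1 s - f2 s)%R; first exact: measurable_funB.
move=> s c h.
rewrite (h1 s (Num.max c 0)%R); last by apply: filterS h => y ->.
rewrite (h2 s (Num.max (- c) 0)%R); last by apply: filterS h => y ->.
by case: (leP c 0%R); case: (leP (- c)%R 0%R); lra.
Qed.

End SigmaFinite.

(** * Random motions *)

Section RandomMotion.
Context {R : realType}.
Variables (nu : {measure set (Gr32 R) -> \bar R})
  (dE : {sigma_finite_measure set (plane R) -> \bar R}).
Hypotheses (hnu : is_grassmann_measure nu) (hdE : is_plane_measure nu dE).
Implicit Types (M : 'M[R]_3) (v w : 'rV[R]_3).

Local Notation mR := (measurableTypeR R).
Local Notation X := (plane R * plane R)%type.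
Local Notation Y := (X * (mR * mR * mR))%type.

Definition motion_measure : {sigma_finite_measure set Y -> \bar R} :=
  sfprod (sfprod dE dE) leb3.

Local Notation rho := motion_measure.

(** This is a genuine motion only when [y.1] is nonparallel: otherwise two axes of the frame vanish.
    By [ae_motion_nonpar] such [y] are negligible. *)
Definition random_motion (e : {ffun 'I_3 -> bool}) (y : Y) (x : X) : X :=
  pact (frame e y.1) (vec y.2) x.

Lemma measurable_vec d (T : measurableType d) (t : T -> mR * mR * mR) i :
  measurable_fun setT t -> measurable_fun setT (fun z => vec (t z) 0 i : R).
Proof.
move=> mt; move: i; apply: ord3P; under eq_fun do rewrite vec3E.
- exact: (measurableT_comp measurable_fst (measurableT_comp measurable_fst mt)).
- exact: (measurableT_comp measurable_snd (measurableT_comp measurable_fst mt)).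
- exact: (measurableT_comp measurable_snd mt).
Qed.

Lemma measurable_random_motion d (T : measurableType d) e
    (y : T -> Y) (x : T -> X) :
  measurable_fun setT y -> measurable_fun setT x ->
  measurable_fun setT (fun z => random_motion e (y z) (x z)).
Proof.
move=> my mx; apply: measurable_pact => //.
- move=> i j; apply: (measurableT_comp (measurable_frame e i j)).
  exact: (measurableT_comp measurable_fst my).
- by move=> i; apply: measurable_vec; exact: (measurableT_comp measurable_snd my).
Qed.

Lemma ae_motion_fst (P : X -> Prop) :
  {ae (dE \x dE)%E, forall E, P E} -> {ae rho, forall y : Y, P y.1}.
Proof.
case=> N [mN N0 PN]; exists (N `*` setT); split.
- exact: measurableX.
- have := @product_measure1E _ _ _ _ _ (sfprod dE dE) leb3 N setT mN measurableT.
  by rewrite [X in (X * _)%E]N0 mul0e.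
- by move=> y /= /PN.
Qed.

Lemma ae_motion_nonpar : {ae rho, forall y : Y, nonpar y.1}.
Proof. exact: (ae_motion_fst (ae_nonpar hnu hdE)). Qed.

Section Ft.
Variable ft : X -> R.
Hypotheses (mft : measurable_fun setT ft)
  (hft : forall M v, orth M ->
    {ae (dE \x dE)%E, forall E, ft (pact M v E) = ft E}).

(* [typical_value x c] is exactly, not just almost everywhere, invariant in [x]:
   see [typical_value_pact]. *)
Definition typical_value (x : X) (c : R) : Prop :=
  forall e, {ae rho, forall y : Y, ft (random_motion e y x) = c}.

(** For almost every fixed [y] the random motion is a motion, so [hft] gives the equality for almost
    every [x]; the two quantifiers are then exchanged. *)
Lemma ae_typical_value :
  {ae (dE \x dE)%E, forall x, typical_value x (ft x)}.
Proof.
apply: filter_forall => e.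
pose P : set (X * Y) := [set z | ft (random_motion e z.2 z.1) = ft z.1].
apply: (@ae_product_swap _ _ _ _ _ (sfprod dE dE) rho P).
  have m1 : measurable_fun setT
      (fun z : X * Y => ft (random_motion e z.2 z.1)).
    apply: (measurableT_comp mft).
    by apply: measurable_random_motion.
  have m2 : measurable_fun setT (fun z : X * Y => ft z.1).
    exact: (measurableT_comp mft measurable_fst).
  have /(_ measurableT [set true]) := measurable_fun_eqr m1 m2.
  rewrite setTI (_ : _ @^-1` _ = P); first exact.
  by apply/seteqP; split => z /= /eqP.
apply: filterS ae_motion_nonpar => y /(frame_orth e) hy.
exact: (hft (vec y.2) hy).
Qed.

Lemma typical_value_pact x c M w : orth M ->
  typical_value x c -> typical_value (pact M w x) c.
Proof.
move=> hM hx e; have hMT := orthT hM.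
(* Moving [x] by [(M, w)] and then by the motion of [y] amounts, up to signs of the frame, to moving
   [x] by the motion of [T y]. [T] preserves [rho], being a translation over a motion of pairs. *)
pose T (y : Y) : Y := (pact M^T 0 y.1, shift3 (w *m frame e y.1) y.2).
have mT : measurable_fun setT (pact M^T 0 : X -> X).
  exact: measurable_pact_cst.
have mw i : measurable_fun setT (fun z : Y => (w *m frame e z.1) 0 i).
  under eq_fun do rewrite mxE sum3.
  have mm j : measurable_fun setT (fun z : Y => w 0 j * frame e z.1 j i).
    apply: measurable_funM => //.
    exact: (measurableT_comp (measurable_frame e j i) measurable_fst).
  by apply: measurable_funD; [apply: measurable_funD|]; exact: mm.
have ms : measurable_fun setT
    (fun z : Y => shift3 (w *m frame e z.1) z.2).
  have mt : measurable_fun setT (fun z : Y => z.2) := measurable_snd.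
  apply: measurable_fun_pair; first apply: measurable_fun_pair.
  - apply: (@measurable_funD _ _ R) => //.
    exact: (measurableT_comp measurable_fst (measurableT_comp measurable_fst mt)).
  - apply: (@measurable_funD _ _ R) => //.
    exact: (measurableT_comp measurable_snd (measurableT_comp measurable_fst mt)).
  - apply: (@measurable_funD _ _ R) => //.
    exact: (measurableT_comp measurable_snd mt).
have rT A : measurable A -> rho (T @^-1` A) = rho A.
  apply: (@skew_product_preserving _ _ _ _ _ (sfprod dE dE) leb3 (pact M^T 0)
    (fun E t => shift3 (w *m frame e E) t)) => //.
  - by move=> B mB; exact: (pact_preserving hdE).
  - by move=> E B mB; exact: leb3_shift.
have mTT : measurable_fun setT T.
  apply: measurable_fun_pair => //.
  exact: (measurableT_comp mT measurable_fst).
(* The signs [e'] given by [frame_pact] depend on [y], so one null set must serve all of the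
   finitely many sign choices. *)
have hT : {ae rho, forall y : Y, forall e', ft (random_motion e' (T y) x) = c}.
  apply: filter_forall => e'.
  exact: (ae_preserving mTT rT (hx e')).
apply: filterS2 hT ae_motion_nonpar => y hy ny.
have [e' he'] := frame_pact 0 e hM ny.
rewrite -(hy e') /random_motion pactM //; last exact: frame_orth.
by rewrite he' vec_shift3 addrC.
Qed.

End Ft.

Definition canonical_pair (s : R) : X :=
  (mkplane (vec3 1 0 0) 0, mkplane (vec3 s (Num.sqrt (1 - s ^+ 2)) 0) 0).

Lemma measurable_canonical_pair : measurable_fun setT canonical_pair.
Proof.
apply: measurable_fun_pair; apply: measurable_mkplane => //.
by apply: measurable_fun_sqrt; apply: measurable_funB.
Qed.

End RandomMotion.

(** * Normal form of a pair of nonparallel planes *)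

Section CanonicalPair.
Context {R : realType}.
Implicit Types (M : 'M[R]_3) (u v w : 'rV[R]_3) (E : plane R * plane R).

Lemma normal_pm (E : plane R) u d : dot u u = 1 -> plane_set E = hplane u d ->
  u = normal E \/ u = - normal E.
Proof.
move=> u1; rewrite normal_offset => /hplane_inj[] //; last by case; right.
- exact: normal1.
- by case; left.
Qed.

Lemma canonical_pair_motion E u v : nonpar E ->
  unit_normal (direction E.1) u -> unit_normal (direction E.2) v ->
  exists M w, orth M /\ pact M w E = canonical_pair `|dot u v|.
Proof.
move=> hE /unit_normal_hplane[u1 [a ha]] /unit_normal_hplane[v1 [b hb]].
have uv : dot u v ^+ 2 != 1.
  move: hE; rewrite /nonpar; have [->|->] := normal_pm u1 ha;
    have [->|->] := normal_pm v1 hb;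
    by rewrite ?dotNl ?dotNr ?opprK ?sqrrN.
(* Replacing [v] by [- v] and [b] by [- b] describes the same plane and changes the sign of the
   scalar product. *)
wlog s0 : v b v1 hb uv / 0 <= dot u v.
  move=> wl; have [s0|s0] := leP 0 (dot u v); first exact: (wl v b).
  rewrite (_ : `|dot u v| = `|dot u (- v)|); last by rewrite dotNr normrN.
  apply: (wl (- v) (- b)); rewrite ?hplaneN ?dotNl ?dotNr ?opprK ?sqrrN //.
  by rewrite oppr_ge0 ltW.
rewrite ger0_norm //; set s := dot u v; set k := Num.sqrt (1 - s ^+ 2).
have k1 : 0 < 1 - s ^+ 2.
  rewrite subr_gt0 lt_neqAle uv /=.
  by have := cauchy_schwarz u v; rewrite u1 v1 mulr1.
have k0 : k != 0 by rewrite sqrtr_eq0 -ltNge.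
have kk : k * k = 1 - s ^+ 2 by rewrite -expr2 sqr_sqrtr // ltW.
pose M := (\matrix_i gram_schmidt u v i)^T.
have hM : orth M by apply/orthT/gram_schmidt_orth.
have MiE z i : (z *m M) 0 i = dot z (gram_schmidt u v i).
  by rewrite /M -dot_row rowK.
have uM : u *m M = vec3 1 0 0.
  apply: row3P; rewrite MiE vec3E /gram_schmidt /= ?dotZr ?dot_crossl ?mulr0 //.
  by rewrite dotBr dotZr u1 mulr1 subrr mulr0.
have vM : v *m M = vec3 s k 0.
  apply: row3P; rewrite MiE vec3E /gram_schmidt /= ?dotZr ?dot_crossr ?mulr0 //.
    by rewrite dotC.
  rewrite dotBr dotZr v1 (dotC v u) -/s -/k -expr2 -kk mulrA mulVf // mul1r.
  by [].
(* The translation [w] brings both planes to the origin: it solves [a + w_0 = 0] and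
   [b + s * w_0 + k * w_1 = 0], while its third coordinate is free. *)
exists M, (vec3 (- a) (- (b - s * a) / k) 0); split => //.
rewrite /pact /canonical_pair; congr (_, _); apply: plane_set_inj.
- rewrite plact_set // ha hplane_image // uM mkplaneE; last first.
    by apply/dot1_neq0; rewrite dot3 !vec3E; ring.
  by congr hplane; rewrite dot3 !vec3E; ring.
- rewrite plact_set // hb hplane_image // vM mkplaneE; last first.
    apply/dot1_neq0; rewrite dot3 !vec3E -/k kk; ring.
  by congr hplane; rewrite dot3 !vec3E; field.
Qed.

End CanonicalPair.

Lemma leb3_setT_neq0 (R : realType) : @leb3 R setT != 0%E.
Proof.
have l0 : @lebesgue_measure R setT != 0%E.
  by rewrite -set_itvNyy lebesgue_measure_itv.
by rewrite /leb3 !sfprod_setT !mule_eq0 !negb_or l0.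
Qed.

Theorem proposition3p1 (R : realType)
    (nu : {measure set (Gr32 R) -> \bar R})
    (dE : {sigma_finite_measure set (plane R) -> \bar R})
    (hnu : is_grassmann_measure nu)
    (hdE : is_plane_measure nu dE)
    (ft : plane R * plane R -> R)
    (hft : measurable_fun setT ft) :
  isometry_invariant (density_measure dE ft) <->
  exists f : R -> R,
    [/\ measurable_fun (`[-1, 1] : set R) f,
        forall t, -1 <= t <= 1 -> f (- t) = f t &
        {ae (dE \x dE)%E, forall E : plane R * plane R,
          forall u1 u2 : 'rV[R]_3,
            unit_normal (direction E.1) u1 -> unit_normal (direction E.2) u2 ->
            ft E = f (dot u1 u2)}].
Proof.
rewrite (isometry_invariant_ae hdE hft); split => [hae|[f [_ _ hf]] M v hM].
  (* The averaging below needs a nonzero measure; for the zero measure every almost sure statement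
     is trivial. *)
  have [m0|m0] := eqVneq ((dE \x dE)%E setT) 0%E.
    exists (cst 0); split => //; exact: (negligibleS (@subsetT _ _)
      ((negligibleP _ measurableT).2 m0)).
  have rho0 : motion_measure dE setT != 0%E.
    rewrite /motion_measure sfprod_setT mule_eq0 negb_or leb3_setT_neq0 andbT.
    exact: m0.
  pose e0 : {ffun 'I_3 -> bool} := [ffun=> false].
  have mq : measurable_fun setT (fun z : R * _ =>
      ft (random_motion e0 z.2 (canonical_pair z.1))).
    apply: (measurableT_comp hft); apply: measurable_random_motion => //.
    exact: (measurableT_comp measurable_canonical_pair measurable_fst).
  have [f mf hf] := ae_constant_value rho0 mq.
  (* Unit normals are defined up to sign, so the canonical pair reached has cosine [|t|]; this also
     makes the function even. *)
  exists (fun t => f `|t|); split.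
  - by apply: measurable_funTS; exact: measurableT_comp.
  - by move=> t _; rewrite normrN.
  apply: filterS2 (ae_typical_value hnu hdE hft hae) (ae_nonpar hnu hdE).
  move=> E hE nE u1 u2 hu1 hu2.
  have [M [w [hM e]]] := canonical_pair_motion nE hu1 hu2.
  (* The typical value [ft E] at [E] is transported to the canonical pair, where [f] reads it
     off. *)
  have := typical_value_pact hnu hdE w hM hE e0.
  by rewrite e => /hf.
(* Conversely, for almost every [E] the formula holds both at [E] and at its image, whose normals
   [u1 *m M] and [u2 *m M] have the same scalar product. *)
have hfv := ae_preserving (measurable_pact_cst M v)
  (fun A => pact_preserving hdE v hM (A := A)) hf.
apply: filterS2 hf hfv => E hE hvE.
have [u1 hu1] := unit_normal_ex E.1; have [u2 hu2] := unit_normal_ex E.2.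
rewrite (hE u1 u2) // -(orth_dot u1 u2 hM); apply: hvE.
- move/unit_normal_hplane: hu1 => [u11 [a ha]]; apply/unit_normal_hplane.
  rewrite orth_dot //; split => //.
  by exists (a + dot (u1 *m M) v); rewrite plact_set // ha hplane_image.
- move/unit_normal_hplane: hu2 => [u21 [a ha]]; apply/unit_normal_hplane.
  rewrite orth_dot //; split => //.
  by exists (a + dot (u2 *m M) v); rewrite plact_set // ha hplane_image.
Qed.
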